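(* Let $p,q$ be integers with $1\leqslant p<q$, and let $BS(p,q)=\langle a,t \mid t a^p t^{-1}=a^q\rangle$ be the Baumslag--Solitar group. Let $\mathfrak{i}(n)=n$ for $n \in \mathbb{N}$. Then $BS(p,q)\in\mathcal{B}_{\mathfrak{i}}$. Moreover, for any $f\in\mathfrak{F}$ with $f\prec\mathfrak{i}$, $BS(p,q)\notin\mathcal{B}_f$.
   Context: All groups considered are finitely generated and infinite. $\mathbb{N}$ is the set of positive integers and $\mathbb{R}^{+}$ the set of non-negative reals. Notation. For a finite generating set $A \subseteq G$ of a group $G$, put $S = A \cup A^{-1}$. $d_A(g_1,g_2)$ denotes the distance between $g_1,g_2\in G$ in the Cayley graph $\Gamma(G,A)$. $\pi : S^* \to G$ is the canonical map sending a word to the group element it represents. Regular relations. For a finite alphabet $\Sigma$ and a padding symbol $\diamond \notin \Sigma$, the convolution $w_1 \otimes w_2$ of $w_1,w_2\in\Sigma^*$ is the string of length $\max\{|w_1|,|w_2|\}$ over $(\Sigma\cup\{\diamond\})^2$ whose $k$th symbol is $(\sigma_1,\sigma_2)$, where $\sigma_i$ is the $k$th symbol of $w_i$ if $k \leqslant |w_i|$ and $\diamond$ otherwise. A binary relation $R \subseteq \Sigma^*\times\Sigma^*$ is regular if $\{w_1\otimes w_2 : (w_1,w_2)\in R\}$ is a regular language (accepted by a finite automaton over $(\Sigma\cup\{\diamond\})^2\setminus\{(\diamond,\diamond)\}$). Cayley automatic representation. A Cayley automatic representation of $G$ (with respect to $A$) is a bijection $\psi: L \to G$, where $L\subseteq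 S^*$ is a regular language, such that for every $a\in A$ the relation $\{(\psi^{-1}(g),\psi^{-1}(ga)) : g\in G\}\subseteq L\times L$ is regular. $G$ is Cayley automatic if it has such a representation. Functions. $\mathfrak{F}$ is the set of all functions $f:[Q,+\infty)\to\mathbb{R}^{+}$, where $[Q,+\infty)\subseteq\mathbb{N}$ is the set of all integers $\geqslant Q$ for some $Q\in\mathbb{N}$ (depending on $f$), with $f(n)\leqslant f(n+1)$ for all $n\in\mathrm{dom}\, f$. For $f,h\in\mathfrak{F}$, write $h\preceq f$ if there exist positive integers $K,M,N$ such that $[N,+\infty)\subseteq \mathrm{dom}\,h\cap\mathrm{dom}\,f$ and $h(n)\leqslant K f(Mn)$ for every integer $n\geqslant N$. Write $h\asymp f$ if $h\preceq f$ and $f\preceq h$; write $h\prec f$ if $h\preceq f$ and not $h\asymp f$. The class $\mathcal{B}_f$. For $f\in\mathfrak{F}$, $\mathcal{B}_f$ is the class of all Cayley automatic groups $G$ for which there exist (for a chosen finite generating set $A$; the property does not depend on this choice) a regular language $L\subseteq S^*$ and a Cayley automatic representation $\psi: L\to G$ such that the function $h(n)=\max\{d_A(\pi(w),\psi(w)) : w\in L,\ |w|\leqslant n\}$ (defined for all $n$ for which $L$ contains a word of length at most $n$) satisfies $h\preceq f$. *)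

(* Defs.v *)
From HB Require Import structures.
From mathcomp Require Import all_boot all_order all_algebra.
From mathcomp Require Import finmap generic_quotient.
From mathcomp Require Import boolp classical_sets functions cardinality reals.

Set Implicit Arguments.
Unset Strict Implicit.
Unset Printing Implicit Defensive.

Import Order.TTheory GRing.Theory Num.Theory.

Local Open Scope classical_set_scope.

(* The letter (x, false) stands for the generator x, and (x, true) for its
   formal inverse. *)
Definition gword (X : Type) := seq (X * bool).

Definition gletter_inv {X : Type} (l : X * bool) : X * bool := (l.1, ~~ l.2).

Definition gword_inv {X : Type} (w : gword X) : gword X :=
  rev (map gletter_inv w).

(* The least congruence on words containing the given relations and free
   cancellation (the case x^-1 x is the instance l = (x, true)). *)
Inductive presentation_eq (X : Type) (rels : set (gword X * gword X)) :
    gword X -> gword X -> Prop :=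
| presentation_rel u v : rels (u, v) -> presentation_eq rels u v
| presentation_cancel l : presentation_eq rels [:: l; gletter_inv l] [::]
| presentation_refl u : presentation_eq rels u u
| presentation_sym u v : presentation_eq rels u v -> presentation_eq rels v u
| presentation_trans u v w :
    presentation_eq rels u v -> presentation_eq rels v w ->
    presentation_eq rels u w
| presentation_cat u u' v v' :
    presentation_eq rels u u' -> presentation_eq rels v v' ->
    presentation_eq rels (u ++ v) (u' ++ v').

Section PresentedGroup.
Variables (X : choiceType) (rels : set (gword X * gword X)).

Definition presentation_eqb (u v : gword X) : bool :=
  `[< presentation_eq rels u v >].

Lemma presentation_eqb_refl : reflexive presentation_eqb.
Proof. by move=> u; apply/asboolP; apply: presentation_refl. Qed.

Lemma presentation_eqb_sym : symmetric presentation_eqb.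
Proof. by move=> u v; apply/asboolP/asboolP; apply: presentation_sym. Qed.

Lemma presentation_eqb_trans : transitive presentation_eqb.
Proof.
by move=> v u w /asboolP uv /asboolP vw; apply/asboolP;
  apply: presentation_trans uv vw.
Qed.

Canonical presentation_equiv := EquivRel presentation_eqb
  presentation_eqb_refl presentation_eqb_sym presentation_eqb_trans.

Local Open Scope quotient_scope.

Definition presented_group := {eq_quot presentation_equiv}.

HB.instance Definition _ := Choice.on presented_group.
HB.instance Definition _ := EqQuotient.on presented_group.

Definition presented_class (w : gword X) : presented_group :=
  \pi_presented_group w.

Lemma presented_classP u v :
  presented_class u = presented_class v <-> presentation_eq rels u v.
Proof.
rewrite /presented_class; split.
  by move=> /eqquotP /asboolP.
by move=> uv; apply/eqquotP/asboolP.
Qed.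

Definition presented_one : presented_group := presented_class [::].

Definition presented_mul (g h : presented_group) : presented_group :=
  presented_class (repr g ++ repr h).

Definition presented_inv (g : presented_group) : presented_group :=
  presented_class (gword_inv (repr g)).

Lemma presented_classK (g : presented_group) : presented_class (repr g) = g.
Proof. exact: reprK. Qed.

Lemma repr_presented_class u :
  presentation_eq rels (repr (presented_class u)) u.
Proof. by apply/presented_classP; rewrite presented_classK. Qed.

Lemma presented_class_cat u v :
  presented_mul (presented_class u) (presented_class v) =
  presented_class (u ++ v).
Proof.
by apply/presented_classP; apply: presentation_cat;
  apply: repr_presented_class.
Qed.

Lemma gletter_invK : involutive (@gletter_inv X).
Proof. by case=> x b; rewrite /gletter_inv /= negbK. Qed.

Lemma gword_invK : involutive (@gword_inv X).
Proof.
by move=> u; rewrite /gword_inv -map_rev revK mapK //; apply: gletter_invK.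
Qed.

Lemma presentation_catV u : presentation_eq rels (u ++ gword_inv u) [::].
Proof.
elim: u => [|l u IHu]; first exact: presentation_refl.
rewrite /gword_inv /= rev_cons -cats1 catA -/(gword_inv u).
apply: presentation_trans (presentation_cancel rels l).
apply: (@presentation_cat _ _ [:: l] [:: l] _ [:: gletter_inv l]).
  exact: presentation_refl.
apply: (@presentation_cat _ _ _ [::]) => //; exact: presentation_refl.
Qed.

Lemma presentation_catNV u : presentation_eq rels (gword_inv u ++ u) [::].
Proof. by have := presentation_catV (gword_inv u); rewrite gword_invK. Qed.

Lemma presented_mulA : associative presented_mul.
Proof.
move=> f g h; rewrite -[f]presented_classK -[g]presented_classK.
by rewrite -[h]presented_classK !presented_class_cat catA.
Qed.

Lemma presented_mul1 : left_id presented_one presented_mul.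
Proof. by move=> g; rewrite -[g]presented_classK presented_class_cat. Qed.

Lemma presented_mulr1 : right_id presented_one presented_mul.
Proof.
by move=> g; rewrite -[g]presented_classK presented_class_cat cats0.
Qed.

Lemma presented_mulV : left_inverse presented_one presented_inv presented_mul.
Proof.
move=> g; rewrite -[X in presented_mul _ X]presented_classK.
rewrite presented_class_cat; apply/presented_classP.
exact: presentation_catNV.
Qed.

Lemma presented_mulrV :
  right_inverse presented_one presented_inv presented_mul.
Proof.
move=> g; rewrite -[X in presented_mul X _]presented_classK.
rewrite presented_class_cat; apply/presented_classP.
exact: presentation_catV.
Qed.

HB.instance Definition _ := isGroup.Build presented_group
  presented_mulA presented_mul1 presented_mulr1 presented_mulV presented_mulrV.

End PresentedGroup.

Inductive bs_gen := BSa | BSt.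

HB.instance Definition _ := gen_eqMixin bs_gen.
HB.instance Definition _ := gen_choiceMixin bs_gen.

Definition bs_rels (p q : nat) : set (gword bs_gen * gword bs_gen) :=
  [set ((BSt, false) :: nseq p (BSa, false) ++ [:: (BSt, true)],
        nseq q (BSa, false))].

Definition BS (p q : nat) : groupType := presented_group (bs_rels p q).

Record dfa (T : Type) := Dfa {
  dfa_state : finType;
  dfa_init : dfa_state;
  dfa_final : {set dfa_state};
  dfa_trans : dfa_state -> T -> dfa_state
}.

Definition dfa_accept (T : Type) (M : dfa T) (w : seq T) : bool :=
  foldl (@dfa_trans T M) (dfa_init M) w \in dfa_final M.

Definition regular (T : finType) (L : set (seq T)) : Prop :=
  exists M : dfa T, L = [set w | dfa_accept M w].

(* None is the padding symbol; the pair of two paddings is not a letter. *)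
Definition conv_letter (T : finType) : finType :=
  {x : option T * option T | x != (None, None)}.

Definition convolution (T : Type) (u v : seq T) : seq (option T * option T) :=
  mkseq (fun k => (onth u k, onth v k)) (maxn (size u) (size v)).

Definition conv_language (T : finType) (rel : set (seq T * seq T)) :
    set (seq (conv_letter T)) :=
  [set w | exists u v, rel (u, v) /\ map val w = convolution u v].

Definition regular_rel (T : finType) (rel : set (seq T * seq T)) : Prop :=
  regular (conv_language rel).

Section Cayley.
Variables (G : groupType) (A : {fset G}).
Local Open Scope group_scope.

Definition sym_gens : {fset G} := (A `|` [fset a^-1 | a in A])%fset.

Definition word_eval (w : seq sym_gens) : G := \big[*%g/1]_(s <- w) val s.

Definition generating : Prop := forall g : G, exists w, word_eval w = g.

Definition cayley_edge : rel G := fun x y =>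
  [exists a : A, (y == x * val a) || (x == y * val a)].

Definition cayley_walk (x y : G) (n : nat) : Prop :=
  exists s : seq G, [/\ path cayley_edge x s, last x s = y & size s = n].

(* The value 0 for disconnected vertices is irrelevant when A generates G. *)
Definition cayley_dist (x y : G) : nat :=
  match pselect (exists n, `[< cayley_walk x y n >]) with
  | left exn => ex_minn exn
  | right _ => 0%N
  end.

(* Only the restriction of psi to L is meaningful. *)
Definition cayley_automatic_rep (L : set (seq sym_gens))
    (psi : seq sym_gens -> G) : Prop :=
  [/\ regular L,
      set_bij L [set: G] psi
    & forall a, a \in A ->
        regular_rel [set uv | exists g : G,
          [/\ L uv.1, L uv.2, psi uv.1 = g & psi uv.2 = g * a]]].

End Cayley.

Definition cayley_automatic (G : groupType) : Prop :=
  exists (A : {fset G}) (L : set (seq (sym_gens A)))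
         (psi : seq (sym_gens A) -> G),
    generating A /\ cayley_automatic_rep L psi.

Local Open Scope ring_scope.

(* The values of pval outside dom are irrelevant. *)
Record nat_pfun (R : realType) := NatPfun {
  dom : set nat;
  pval :> nat -> R
}.

Definition growth_fun (R : realType) (f : nat_pfun R) : Prop :=
  (exists Q, (0 < Q)%N /\ dom f = [set n | (Q <= n)%N]) /\
  (forall n, dom f n -> 0 <= f n /\ f n <= f n.+1).

Definition preceq (R : realType) (h f : nat_pfun R) : Prop :=
  exists K M N : nat,
    [/\ (0 < K)%N, (0 < M)%N, (0 < N)%N,
        [set n | (N <= n)%N] `<=` dom h `&` dom f
      & forall n, (N <= n)%N -> h n <= K%:R * f (M * n)%N].

Definition asymp (R : realType) (h f : nat_pfun R) : Prop :=
  preceq h f /\ preceq f h.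

Definition prec (R : realType) (h f : nat_pfun R) : Prop :=
  preceq h f /\ ~ asymp h f.

Definition ident_fun (R : realType) : nat_pfun R :=
  NatPfun [set n | (0 < n)%N] (fun n => n%:R).

Section Displacement.
Variables (R : realType) (G : groupType) (A : {fset G}).
Variables (L : set (seq (sym_gens A))) (psi : seq (sym_gens A) -> G).

Definition max_displacement (n : nat) : nat :=
  (\max_(w : n.-bseq (sym_gens A) | `[< L w >])
     cayley_dist A (word_eval w) (psi w))%N.

Definition displacement : nat_pfun R :=
  NatPfun [set n | (0 < n)%N /\ exists w, L w /\ (size w <= n)%N]
          (fun n => (max_displacement n)%:R).

Lemma growth_fun_displacement : L !=set0 -> growth_fun displacement.
Proof.
move=> [w0 Lw0]; split.
  pose P n := (0 < n)%N && `[< exists w, L w /\ (size w <= n)%N >].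
  have exP : exists n, P n.
    by exists (size w0).+1; apply/andP; split=> //; apply/asboolP; exists w0.
  exists (ex_minn exP); case: ex_minnP => Q /andP[Q0 /asboolP[w [Lw wQ]]] minQ.
  split=> //; apply/seteqP; split=> n /=.
    by move=> [n0 exn]; apply: minQ; apply/andP; split=> //; apply/asboolP.
  move=> Qn; split; first exact: leq_trans Qn.
  by exists w; split=> //; apply: leq_trans Qn.
move=> n _; split; first exact: ler0n.
rewrite ler_nat; apply/bigmax_leqP => w Lw.
have wn : (size w <= n.+1)%N by apply: leq_trans (size_bseq w) _.
by apply: (leq_bigmax_cond (Bseq wn)).
Qed.

End Displacement.

(* Infiniteness is a standing assumption on the groups considered; finite
   generation is part of the existence of A. *)
Definition class_B (R : realType) (f : nat_pfun R) (G : groupType) : Prop :=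
  [/\ infinite_set [set: G],
      cayley_automatic G
    & exists (A : {fset G}) (L : set (seq (sym_gens A)))
             (psi : seq (sym_gens A) -> G),
        [/\ generating A, cayley_automatic_rep L psi
          & preceq (displacement R L psi) f]].

(* Main.v *)
Require Import Defs.
From mathcomp Require Import all_boot all_order all_algebra.
From mathcomp Require Import finmap zify ring lra.
From mathcomp Require Import boolp classical_sets functions cardinality reals.

Set Implicit Arguments.
Unset Strict Implicit.
Unset Printing Implicit Defensive.

Import Order.TTheory GRing.Theory Num.Theory.

(* Upper bound. Every g in BS(p,q) is uniquely a reduced product of syllables
   a^i t (i < q) and a^i t^-1 (i < p), followed by a power a^k. Writing the
   syllables and the balanced ternary digits of k on two parallel tracks makes
   right multiplication by a and t a synchronous regular relation, and since
   a^k has length O(log k), an element written with n letters has length O(n).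

   Lower bound. For a representation psi, let x_j(g) be the element spelled by
   the length j prefix of psi^-1(g). Regularity and a displacement h(n) give
   d(x_j(g), x_j(gs)) = O(h(n) + 1), so a loop of length O(n) is filled by
   O(n^2) squares of perimeter O(h(n) + 1). An area functional, antisymmetric
   in its two arguments, is at most exponential in the perimeter on each square
   but exponential in n on the commutators [u_n, a], where u_n is a word of
   length O(n) for a^N with N >= (q/p)^n. Hence h(Mn) is at least linear. *)

(** * Automata *)

(** The area functional models the integral of the offset in the affine action [a : x -> x + 1],
    [t : x -> (q/p) x] against a height. If the height were the exponent of [t], the contributions
    of [u_n] and [u_n^-1] to the commutator would cancel, since integrals along closed height
    profiles do not see a translation of the offset. The height is therefore replaced by a level
    that changes only on certain edges, selected by divisibility of the offset by q. This condition
    is compatible with the relation [t a^p t^-1 = a^q], but the letter [a] between [u_n] and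
    [u_n^-1] moves the latter off the selected edges, as q > 1. Selecting only edges issued from
    slope 1 serves the bound on squares: at large slope a single letter may shift the offset
    arbitrarily far, whereas a square on which the level changes has a point of slope 1 nearby, and
    from there n letters shift the offset by at most q^n. Area is defined on pairs of group
    elements, not on edge paths, so no geodesics have to be chosen for the sides of squares. *)

Lemma foldl_dfa_short_completion (T : Type) (M : dfa T) (P : pred T)
    (s : dfa_state M) (w : seq T) :
  all P w -> foldl (@dfa_trans T M) s w \in dfa_final M ->
  exists w', [/\ all P w', size w' <= #|dfa_state M|
               & foldl (@dfa_trans T M) s w' \in dfa_final M].
Proof.
(* Edges carry letters satisfying [P]; a duplicate-free path in this graph is no longer than the
   number of states. *)
pose e := [rel x y : dfa_state M | `[< exists c, P c /\ dfa_trans x c = y >]].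
have run (x : dfa_state M) u : all P u -> connect e x (foldl (@dfa_trans T M) x u).
  elim: u x => [|c u IHu] x //= /andP[Pc Pu].
  apply: connect_trans (IHu _ Pu); apply: connect1.
  by apply/asboolP; exists c.
move=> Pw; case/connectP: (run s w Pw) => r er ->.
case/shortenP: er => r' er' /= /andP[_ Ur'] _ finr'.
have /= szr' : size r' <= #|dfa_state M| by rewrite -(card_uniqP Ur') max_card.
suff [w' [Pw' szw' rw']] : exists w', [/\ all P w', size w' = size r'
    & foldl (@dfa_trans T M) s w' = last s r'].
  by exists w'; rewrite szw' rw'.
elim: r' s er' {Ur' finr' szr' run} => [|y r' IHr] x /=; first by exists [::].
move=> /andP[/asboolP[c [Pc cy]] er']; have [w' [Pw' szw' rw']] := IHr y er'.
by exists (c :: w'); rewrite /= Pc Pw' szw' cy rw'.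
Qed.

Section Convolution.
Variable T : Type.
Implicit Types u v : seq T.

Lemma map_fst_convolution u v :
  map fst (convolution u v) = map Some u ++ nseq (size v - size u) None.
Proof.
rewrite /convolution /mkseq -map_comp -/(mkseq _ _); apply: (@eq_from_nth _ None).
  by rewrite size_mkseq size_cat size_map size_nseq; lia.
move=> i; rewrite size_mkseq => ilt; rewrite nth_mkseq //= onthE nth_cat.
rewrite size_map nth_nseq if_same; case: ltnP => // szu.
by rewrite nth_default ?size_map.
Qed.

Lemma map_snd_convolution u v :
  map snd (convolution u v) = map Some v ++ nseq (size u - size v) None.
Proof.
rewrite /convolution /mkseq -map_comp -/(mkseq _ _); apply: (@eq_from_nth _ None).
  by rewrite size_mkseq size_cat size_map size_nseq; lia.
move=> i; rewrite size_mkseq => ilt; rewrite nth_mkseq //= onthE nth_cat.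
rewrite size_map nth_nseq if_same; case: ltnP => // szu.
by rewrite nth_default ?size_map.
Qed.

(** Two padded tracks alone leave the number of trailing paddings open; the ban on double padding
    pins the length to that of the longer word. *)
Lemma convolution_unique u v n m (w : seq (option T * option T)) :
  all (fun x => isSome x.1 || isSome x.2) w ->
  map fst w = map Some u ++ nseq n None ->
  map snd w = map Some v ++ nseq m None -> w = convolution u v.
Proof.
move=> nz w1 w2.
have sz1 : size w = size u + n.
  by rewrite -(size_map fst) w1 size_cat size_map size_nseq.
have sz2 : size w = size v + m.
  by rewrite -(size_map snd) w2 size_cat size_map size_nseq.
have pad u' k i : onth u' i = nth None (map Some u' ++ nseq k None) i :> option T.
  rewrite onthE nth_cat nth_nseq if_same size_map; case: ltnP => // szu.
  by rewrite nth_default ?size_map.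
have nthw i : i < size w -> nth (None, None) w i = (onth u i, onth v i).
  move=> iw; rewrite (pad u n) (pad v m) -w1 -w2 !(nth_map (None, None)) //.
  by case: nth.
have szw : size w = maxn (size u) (size v).
  apply/eqP; rewrite eqn_leq; apply/andP; split; last by lia.
  rewrite leqNgt; apply/negP => lt.
  have iw : maxn (size u) (size v) < size w by [].
  have /(all_nthP (None, None))/(_ _ iw) := nz.
  by rewrite nthw // !onth_default //; lia.
apply: (@eq_from_nth _ (None, None)); first by rewrite size_mkseq.
by move=> i iw; rewrite nth_mkseq -?szw // nthw.
Qed.

End Convolution.

Lemma pmap_id_pad (T : Type) (u : seq T) n :
  pmap id (map Some u ++ nseq n None) = u.
Proof.
by elim: u => [|x u /= ->] //=; elim: n.
Qed.

Section Recognizable.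
Local Open Scope classical_set_scope.

(** Any type of letters is allowed, so that automata can be pulled back along decodings and
    projections to tracks before the final passage to [regular]. *)
Definition recognizable (T : Type) (P : set (seq T)) : Prop :=
  exists M : dfa T, forall w, P w <-> dfa_accept M w.

Lemma recognizable_regular (T : finType) (P : set (seq T)) :
  recognizable P -> regular P.
Proof. by case=> M PM; exists M; apply/seteqP; split=> w /PM. Qed.

Lemma eq_recognizable (T : Type) (P Q : set (seq T)) :
  (forall w, P w <-> Q w) -> recognizable P -> recognizable Q.
Proof.
by move=> PQ [M PM]; exists M => w; split=> [/PQ/PM|/PM/PQ].
Qed.

Lemma recognizable_fold (T : Type) (S : finType) (s0 : S) (step : S -> T -> S)
    (acc : pred S) :
  recognizable (fun w => acc (foldl step s0 w)).
Proof.
exists (@Dfa T S s0 [set s | acc s]%SET step) => w.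
by rewrite /dfa_accept inE.
Qed.

(** Lets states be taken from an infinite type, such as integer carries, once a finite list of them
    is closed under the transitions. *)
Lemma recognizable_fold_closed (T : Type) (S : choiceType) (F : seq S) (s0 : S)
    (step : S -> T -> S) (acc : pred S) :
  s0 \in F -> (forall s x, s \in F -> step s x \in F) ->
  recognizable (fun w => acc (foldl step s0 w)).
Proof.
move=> F0 Fstep.
pose step' (s : seq_sub F) x := SeqSub (Fstep _ x (ssvalP s)).
apply: eq_recognizable
  (recognizable_fold (SeqSub F0) step' (fun s => acc (ssval s))) => w.
suff -> : ssval (foldl step' (SeqSub F0) w) = foldl step s0 w by [].
rewrite -[s0 in RHS]/(ssval (SeqSub F0)).
by elim: w (SeqSub F0) => //= x w IHw s; rewrite IHw.
Qed.

Lemma recognizableI (T : Type) (P Q : set (seq T)) :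
  recognizable P -> recognizable Q -> recognizable (P `&` Q).
Proof.
move=> [M PM] [N QN].
pose step (s : dfa_state M * dfa_state N) x :=
  (dfa_trans s.1 x, dfa_trans s.2 x).
apply: eq_recognizable (recognizable_fold (dfa_init M, dfa_init N) step
  (fun s => (s.1 \in dfa_final M) && (s.2 \in dfa_final N))) => w.
have -> s : foldl step s w =
    (foldl (@dfa_trans T M) s.1 w, foldl (@dfa_trans T N) s.2 w).
  by elim: w s => [|x w IHw] [s t] //=; rewrite IHw.
by split=> [/andP[? ?]|[/PM ? /QN ?]]; [split; [apply/PM|apply/QN]|apply/andP].
Qed.

Lemma recognizableC (T : Type) (P : set (seq T)) :
  recognizable P -> recognizable (~` P).
Proof.
move=> [M PM]; exists (@Dfa T _ (dfa_init M) (~: dfa_final M)%SET (@dfa_trans T M)).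
move=> w; rewrite /dfa_accept inE /=; split; first by move=> nP; apply/negP => /PM.
by move=> /negP nM /PM.
Qed.

Lemma recognizableU (T : Type) (P Q : set (seq T)) :
  recognizable P -> recognizable Q -> recognizable (P `|` Q).
Proof.
move=> rP rQ.
have := recognizableC (recognizableI (recognizableC rP) (recognizableC rQ)).
by rewrite setCI !setCK.
Qed.

Lemma recognizable0 (T : Type) : recognizable (@set0 (seq T)).
Proof.
by apply: eq_recognizable (recognizable_fold tt (fun _ (_ : T) => tt) pred0).
Qed.

Lemma recognizable_exists (T : Type) (I : finType) (P : I -> set (seq T)) :
  (forall i, recognizable (P i)) -> recognizable (fun w => exists i, P i w).
Proof.
move=> rP.
suff : recognizable (fun w => exists2 i, i \in enum I & P i w).
  by apply: eq_recognizable => w; split=> [[i _ Pi]|[i Pi]]; exists i;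
    rewrite ?mem_enum.
elim: (enum I) => [|i s IHs].
  by apply: eq_recognizable (recognizable0 T) => w; split=> [|[]].
apply: eq_recognizable (recognizableU (rP i) IHs) => w; split.
  by case=> [Pi|[j js Pj]]; [exists i|exists j]; rewrite ?inE ?eqxx // js orbT.
case=> j; rewrite inE => /predU1P[->|js] Pj; [by left|by right; exists j].
Qed.

Lemma recognizable_map (T T' : Type) (f : T -> T') (P : set (seq T')) :
  recognizable P -> recognizable (fun w => P (map f w)).
Proof.
move=> [M PM].
apply: eq_recognizable (recognizable_fold (dfa_init M)
  (fun s x => dfa_trans s (f x)) (fun s => s \in dfa_final M)) => w.
have -> s : foldl (fun s x => dfa_trans s (f x)) s w =
    foldl (@dfa_trans T' M) s (map f w) by elim: w s => //=.
by split=> /PM.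
Qed.

Lemma recognizable_all (T : Type) (a : pred T) :
  recognizable (fun w => all a w).
Proof.
apply: eq_recognizable (recognizable_fold true
  (fun s x => s && a x) id) => w.
have -> s : foldl (fun s x => s && a x) s w = s && all a w.
  by elim: w s => [|x w IHw] s /=; rewrite ?andbT // IHw andbA.
by [].
Qed.

Lemma recognizable_last (T : Type) (a : pred T) :
  recognizable (fun w => last true (map a w)).
Proof.
apply: eq_recognizable (recognizable_fold true (fun _ x => a x) id) => w.
have -> s : foldl (fun _ x => a x) s w = last s (map a w).
  by elim: w s => //=.
by [].
Qed.

Lemma recognizable_sorted (T : finType) (r : rel T) :
  recognizable (fun w => sorted r w).
Proof.
pose step (s : option (option T)) x :=
  match s with
  | None => None
  | Some None => Some (Some x)
  | Some (Some y) => if r y x then Some (Some x) else None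
  end.
apply: eq_recognizable (recognizable_fold (Some None) step isSome) => w.
have step0 u : foldl step None u = None by elim: u.
suff stepS u y : isSome (foldl step (Some (Some y)) u) = path r y u.
  by case: w => //= x w; rewrite stepS.
elim: u y => //= x u IHu y; case: (r y x) => //=.
by rewrite step0.
Qed.

Lemma recognizable_pad (T : Type) (P : set (seq T)) :
  recognizable P ->
  recognizable (fun w => exists u n, w = map Some u ++ nseq n None /\ P u).
Proof.
move=> [M PM].
pose step (s : option (dfa_state M * bool)) x :=
  match s, x with
  | Some (s, false), Some x => Some (dfa_trans s x, false)
  | Some (s, _), None => Some (s, true)
  | _, _ => None
  end.
pose acc (s : option (dfa_state M * bool)) :=
  if s is Some (s, _) then s \in dfa_final M else false.
apply: eq_recognizable (recognizable_fold (Some (dfa_init M, false)) step acc).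
move=> w; have step0 u : foldl step None u = None by elim: u.
have stepN s b n : acc (foldl step (Some (s, b)) (nseq n None)) = (s \in dfa_final M).
  by elim: n b => //= n IHn [].
have stepT s u : acc (foldl step (Some (s, true)) u) ->
    exists n, u = nseq n None /\ s \in dfa_final M.
  elim: u => [|[x|] u IHu] /=; first by exists 0.
    by rewrite step0.
  by move=> /IHu[n [-> sM]]; exists n.+1.
have stepF s : acc (foldl step (Some (s, false)) w) <->
    exists u n, w = map Some u ++ nseq n None /\
      foldl (@dfa_trans T M) s u \in dfa_final M.
  split; last first.
    case=> u [n [-> uM]]; rewrite foldl_cat.
    suff -> : foldl step (Some (s, false)) (map Some u) =
      Some (foldl (@dfa_trans T M) s u, false) by rewrite stepN.
    by elim: u s {uM} => //=.
  elim: w s => [|[x|] w IHw] s /=; first by exists [::], 0.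
    by move=> /IHw[u [n [-> uM]]]; exists (x :: u), n.
  by move=> /stepT[n [-> sM]]; exists [::], n.+1.
apply: iff_trans (stepF _) _.
by split=> -[u [n [-> /PM Pu]]]; exists u, n.
Qed.

(** [Q] has to be right on convolutions of words of [L] only: the shape of the padding is checked on
    each track separately, and [conv_letter] excludes double padding. *)
Lemma regular_rel_recognizable (T : finType) (L : set (seq T))
    (Q : set (seq (option T * option T))) (R : set (seq T * seq T)) :
  recognizable L -> recognizable Q ->
  (forall u v, R (u, v) <-> [/\ L u, L v & Q (convolution u v)]) ->
  regular_rel R.
Proof.
move=> rL rQ RE; apply: recognizable_regular.
have rLp := recognizable_pad rL.
have rfst := recognizable_map fst rLp; have rsnd := recognizable_map snd rLp.
have rFSQ := recognizableI (recognizableI (rfst _) (rsnd _)) rQ.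
have rval := @recognizable_map (conv_letter T) _ val _ rFSQ.
apply: eq_recognizable rval => w.
split=> [[[]]|[u [v [/RE[Lu Lv Quv] wE]]]].
  move=> [u [n [w1 Lu]]] [v [m [w2 Lv]]] Qw.
  have nz : all (fun x => isSome x.1 || isSome x.2) (map val w).
    by rewrite all_map; apply/allP => -[[[x|] [y|]] //= nz] _.
  by exists u, v; rewrite RE -(convolution_unique nz w1 w2).
rewrite wE; do 2![split=> //]; first by rewrite map_fst_convolution; exists u; eexists.
by rewrite map_snd_convolution; exists v; eexists.
Qed.

End Recognizable.

(** * Normal forms *)

Section PresentedClass.
Variables (X : choiceType) (rels : set (gword X * gword X)).
Local Open Scope group_scope.
Notation cls := (presented_class rels : gword X -> presented_group rels).

Lemma presented_classM u v : cls (u ++ v) = cls u * cls v.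
Proof. by rewrite -presented_class_cat. Qed.

Lemma presented_class_nil : cls [::] = 1.
Proof. by []. Qed.

Lemma presented_class_cons l w : cls (l :: w) = cls [:: l] * cls w.
Proof. exact: (presented_classM [:: l] w). Qed.

Lemma presented_class_letterV l : cls [:: gletter_inv l] = (cls [:: l])^-1.
Proof.
apply/esym/mulg1_eq; rewrite -presented_classM.
exact/presented_classP/presentation_cancel.
Qed.

Lemma presented_class_nseq n l : cls (nseq n l) = cls [:: l] ^+ n.
Proof.
by elim: n => [|n IHn] //=; rewrite presented_class_cons IHn expgS.
Qed.

End PresentedClass.

Section Zpow.
Local Open Scope group_scope.
Variable G : groupType.
Implicit Type g : G.

Definition zpow g (k : int) : G :=
  match k with Posz n => g ^+ n | Negz n => g ^- n.+1 end.

Lemma zpowS g k : zpow g (k + 1)%R = zpow g k * g.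
Proof.
case: k => [n|[|n]].
- by rewrite -PoszD addn1 /= expgSr.
- by rewrite /= mulVg.
- have -> : (Negz n.+1 + 1)%R = Negz n by lia.
  by rewrite /= [g ^+ n.+2]expgS invgM mulgVK.
Qed.

Lemma zpowD g j k : zpow g (j + k)%R = zpow g j * zpow g k.
Proof.
case: k => n.
  elim: n => [|n IHn]; first by rewrite addr0 /= mulg1.
  by rewrite -addn1 PoszD addrA !zpowS IHn mulgA.
elim: n => [|n IHn].
  by apply: (mulIg g); rewrite -zpowS /= -mulgA mulVg mulg1; congr zpow; lia.
apply: (mulIg g); rewrite -zpowS -mulgA -zpowS.
have -> : (Negz n.+1 + 1)%R = Negz n by lia.
by rewrite -IHn; congr zpow; lia.
Qed.

Lemma zpowN g k : zpow g (- k)%R = (zpow g k)^-1.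
Proof. by apply/esym/mulg1_eq; rewrite -zpowD subrr. Qed.

Lemma zpow_conj g h j k m : zpow g j ^ h = zpow g k ->
  zpow g (j * m)%R ^ h = zpow g (k * m)%R.
Proof.
move=> gh; case: m => n; last first.
  rewrite NegzE !mulrN !zpowN conjVg; congr (_^-1); move: n.+1 => {}n.
  elim: n => [|n IHn]; first by rewrite !mulr0 conj1g.
  by rewrite -addn1 PoszD !mulrDr !mulr1 !zpowD conjMg IHn gh.
elim: n => [|n IHn]; first by rewrite !mulr0 conj1g.
by rewrite -addn1 PoszD !mulrDr !mulr1 !zpowD conjMg IHn gh.
Qed.

End Zpow.

Section NormalForm.
Variables p' q' : nat.
Notation p := p'.+1.
Notation q := q'.+1.
Notation G := (BS p q).
Notation cls := (presented_class (bs_rels p q) : gword bs_gen -> G).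

Definition bs_a : G := cls [:: (BSa, false)].
Definition bs_t : G := cls [:: (BSt, false)].

Section Relation.
Local Open Scope group_scope.

Lemma bs_relation : bs_t * bs_a ^+ p * bs_t^-1 = bs_a ^+ q.
Proof.
transitivity (cls ([:: (BSt, false)] ++ nseq p (BSa, false) ++ [:: (BSt, true)])).
  rewrite 2!presented_classM presented_class_nseq -mulgA; congr (_ * (_ * _)).
  by rewrite -(presented_class_letterV _ (BSt, false)).
rewrite -presented_class_nseq; apply/presented_classP; exact: presentation_rel.
Qed.

Lemma zpow_bs_t m :
  zpow bs_a (q%:Z * m)%R * bs_t = bs_t * zpow bs_a (p%:Z * m)%R.
Proof.
rewrite conjgC; congr (_ * _); apply: zpow_conj.
by rewrite /= -bs_relation conjgE !mulgA mulVg mul1g mulgVK.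
Qed.

Lemma zpow_bs_tV m :
  zpow bs_a (p%:Z * m)%R * bs_t^-1 = bs_t^-1 * zpow bs_a (q%:Z * m)%R.
Proof.
by apply: (mulgI bs_t); rewrite mulgA -zpow_bs_t mulgK mulVKg.
Qed.

End Relation.

(* [inl i] stands for a^i t and [inr i] for a^i t^-1. *)
Definition syllable : finType := ('I_q + 'I_p)%type.

(* [(s, k)] stands for the product of the syllables of [s], the head of [s]
   being the rightmost one, followed by a^k. *)
Definition bs_form : Type := (seq syllable * int)%type.

(** Britton's condition, with [x] standing to the right of [y]: no [t] and [t^-1] may meet and
    cancel. *)
Definition sub_reduced (x y : syllable) : bool :=
  match x, y with
  | inr i, inl _ => i != 0 :> nat
  | inl i, inr _ => i != 0 :> nat
  | _, _ => true
  end.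

Definition reduced (x : bs_form) : bool := sorted sub_reduced x.1.

(** Right multiplication by [t]: for [k = q m + r] one has [a^k t = a^r t a^(p m)], and if [r = 0]
    the new [t] cancels against a final syllable [a^i t^-1], leaving [a^(i + p m)]. *)
Definition form_t (x : bs_form) : bs_form :=
  let m := (x.2 %/ q%:Z)%Z in let r := (x.2 %% q%:Z)%Z in
  match x.1 with
  | inr i :: s => if r == 0 then (s, i%:Z + p%:Z * m)%R
                  else (inl (inord `|r|) :: x.1, (p%:Z * m)%R)
  | _ => (inl (inord `|r|) :: x.1, (p%:Z * m)%R)
  end.

Definition form_tV (x : bs_form) : bs_form :=
  let m := (x.2 %/ p%:Z)%Z in let r := (x.2 %% p%:Z)%Z in
  match x.1 with
  | inl i :: s => if r == 0 then (s, i%:Z + q%:Z * m)%R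
                  else (inr (inord `|r|) :: x.1, (q%:Z * m)%R)
  | _ => (inr (inord `|r|) :: x.1, (q%:Z * m)%R)
  end.

Definition form_act (x : bs_form) (l : bs_gen * bool) : bs_form :=
  match l with
  | (BSa, false) => (x.1, x.2 + 1)%R
  | (BSa, true) => (x.1, x.2 - 1)%R
  | (BSt, false) => form_t x
  | (BSt, true) => form_tV x
  end.

Variant form_t_spec (x : bs_form) : bs_form -> Type :=
| FormTPop (i : 'I_p) s m of x = (inr i :: s, q%:Z * m)%R :
    form_t_spec x (s, i%:Z + p%:Z * m)%R
| FormTPush (i : 'I_q) m of x.2 = (i%:Z + q%:Z * m)%R
    & (reduced x -> reduced (inl i :: x.1, 0%R)) :
    form_t_spec x (inl i :: x.1, p%:Z * m)%R.

Variant form_tV_spec (x : bs_form) : bs_form -> Type :=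
| FormTVPop (i : 'I_q) s m of x = (inl i :: s, p%:Z * m)%R :
    form_tV_spec x (s, i%:Z + q%:Z * m)%R
| FormTVPush (i : 'I_p) m of x.2 = (i%:Z + p%:Z * m)%R
    & (reduced x -> reduced (inr i :: x.1, 0%R)) :
    form_tV_spec x (inr i :: x.1, q%:Z * m)%R.

Lemma modz_ord n (k : int) :
  Posz (inord `|(k %% n.+1%:Z)%Z| : 'I_n.+1) = (k %% n.+1%:Z)%Z.
Proof.
have := ltz_pmod k (isT : (0 < n.+1%:Z)%R); have := modz_ge0 k (isT : n.+1%:Z != 0)%R.
case: (k %% n.+1%:Z)%Z => //= m _ mn; rewrite inordK //; lia.
Qed.

Lemma form_tP x : form_t_spec x (form_t x).
Proof.
have def : (x.2 = (inord `|(x.2 %% q%:Z)%Z| : 'I_q)%:Z + q%:Z * (x.2 %/ q%:Z)%Z)%R.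
  by rewrite modz_ord addrC mulrC -divz_eq.
case: x def => [[|[j|j] s] k] /= def; rewrite /form_t /=.
- by right.
- by right.
- case: eqP => r0; first by left; rewrite {1}(divz_eq k q%:Z) r0 addr0 mulrC.
  right=> //; rewrite /reduced /= => ->; rewrite andbT.
  by apply/eqP => i0; apply: r0; rewrite -modz_ord i0.
Qed.

Lemma form_tVP x : form_tV_spec x (form_tV x).
Proof.
have def : (x.2 = (inord `|(x.2 %% p%:Z)%Z| : 'I_p)%:Z + p%:Z * (x.2 %/ p%:Z)%Z)%R.
  by rewrite modz_ord addrC mulrC -divz_eq.
case: x def => [[|[j|j] s] k] /= def; rewrite /form_tV /=.
- by right.
- case: eqP => r0; first by left; rewrite {1}(divz_eq k p%:Z) r0 addr0 mulrC.
  right=> //; rewrite /reduced /= => ->; rewrite andbT.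
  by apply/eqP => i0; apply: r0; rewrite -modz_ord i0.
- by right.
Qed.

Lemma euclid_inj n (i j : 'I_n.+1) (k m : int) :
  (i%:Z + n.+1%:Z * k = j%:Z + n.+1%:Z * m)%R -> i = j /\ k = m.
Proof.
move=> e; have := ltn_ord i; have := ltn_ord j => jn ni.
have km : k = m.
  case: (ltgtP k m) => // lt.
    have [d md] : exists d : nat, m = (k + 1 + d%:Z)%R by exists `|(m - k - 1)%R|; lia.
    by subst m; nia.
  have [d kd] : exists d : nat, k = (m + 1 + d%:Z)%R by exists `|(k - m - 1)%R|; lia.
  by subst k; nia.
by split=> //; subst m; apply/val_inj; move/addIr: e => -[].
Qed.

Lemma form_t_push s (i : 'I_q) m : reduced (inl i :: s, 0%R) ->
  form_t (s, i%:Z + q%:Z * m)%R = (inl i :: s, p%:Z * m)%R.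
Proof.
move=> red; case: form_tP => [j s' m' [es e]|j m' /= /euclid_inj[-> ->] //].
have [i0 _] : i = ord0 /\ m = m' by apply: euclid_inj; rewrite e /= add0r.
by move: red; rewrite es i0.
Qed.

Lemma form_t_pop s (i : 'I_p) m :
  form_t (inr i :: s, q%:Z * m)%R = (s, i%:Z + p%:Z * m)%R.
Proof. by rewrite /form_t /= mulrC mulzK // modzMl eqxx. Qed.

Lemma form_tV_push s (i : 'I_p) m : reduced (inr i :: s, 0%R) ->
  form_tV (s, i%:Z + p%:Z * m)%R = (inr i :: s, q%:Z * m)%R.
Proof.
move=> red; case: form_tVP => [j s' m' [es e]|j m' /= /euclid_inj[-> ->] //].
have [i0 _] : i = ord0 /\ m = m' by apply: euclid_inj; rewrite e /= add0r.
by move: red; rewrite es i0.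
Qed.

Lemma form_tV_pop s (i : 'I_q) m :
  form_tV (inl i :: s, p%:Z * m)%R = (s, i%:Z + q%:Z * m)%R.
Proof. by rewrite /form_tV /= mulrC mulzK // modzMl eqxx. Qed.

Lemma reduced_behead x s k : reduced (x :: s, k) -> reduced (s, k).
Proof. exact: path_sorted. Qed.

Lemma form_act_reduced x l : reduced x -> reduced (form_act x l).
Proof.
case: l => [[] []] //= red.
- by case: form_tVP => [i s m ex|i m _ /(_ red)//]; move: red; rewrite ex => /reduced_behead.
- by case: form_tP => [i s m ex|i m _ /(_ red)//]; move: red; rewrite ex => /reduced_behead.
Qed.

Lemma form_tK x : reduced x -> form_tV (form_t x) = x.
Proof.
move=> red; case: form_tP => [i s m ex|i m ex _].
  by move: red; rewrite ex => red; rewrite form_tV_push.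
by rewrite form_tV_pop -ex; case: x {red ex}.
Qed.

Lemma form_tVK x : reduced x -> form_t (form_tV x) = x.
Proof.
move=> red; case: form_tVP => [i s m ex|i m ex _].
  by move: red; rewrite ex => red; rewrite form_t_push.
by rewrite form_t_pop -ex; case: x {red ex}.
Qed.

Lemma form_actK x l : reduced x -> form_act (form_act x l) (gletter_inv l) = x.
Proof.
case: l => [[] []] red; rewrite /form_act /=.
- by rewrite subrK; case: x {red}.
- by rewrite addrK; case: x {red}.
- exact: form_tVK.
- exact: form_tK.
Qed.

Definition form_run (x : bs_form) (w : gword bs_gen) : bs_form :=
  foldl form_act x w.

Lemma form_run_cat x u v : form_run x (u ++ v) = form_run (form_run x u) v.
Proof. exact: foldl_cat. Qed.

Lemma form_run_reduced x w : reduced x -> reduced (form_run x w).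
Proof. by elim: w x => //= l w IHw x /(form_act_reduced l)/IHw. Qed.

Lemma form_run_a s k n : form_run (s, k) (nseq n (BSa, false)) = (s, k + n%:Z)%R.
Proof.
elim: n k => [|n IHn] k /=; first by rewrite addr0.
by rewrite [form_run _ _]IHn; congr (_, _); lia.
Qed.

Lemma form_run_aV s k n : form_run (s, k) (nseq n (BSa, true)) = (s, k - n%:Z)%R.
Proof.
elim: n k => [|n IHn] k /=; first by rewrite subr0.
by rewrite [form_run _ _]IHn; congr (_, _); lia.
Qed.

Lemma form_run_presentation u v : presentation_eq (bs_rels p q) u v ->
  forall x, reduced x -> form_run x u = form_run x v.
Proof.
elim=> {u v} [u v uv|l|u|u v _ IH|u v w _ IHu _ IHv|u u' v v' _ IHu _ IHv] x red //.
- have -> : u = [:: (BSt, false)] ++ nseq p (BSa, false) ++ [:: (BSt, true)].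
    exact: (congr1 fst uv).
  have -> : v = nseq q (BSa, false) by exact: (congr1 snd uv).
  case: x red => s k red; rewrite form_run_a !form_run_cat.
  rewrite -[form_run (s, k) _]/(form_t (s, k)) -[LHS]/(form_tV _).
  case: form_tP red => [i s' m [-> ->]|i m ks redi] red; rewrite form_run_a.
    have -> : (i%:Z + p%:Z * m + p%:Z = i%:Z + p%:Z * (m + 1))%R by ring.
    by rewrite form_tV_push //; congr (_, _); ring.
  rewrite [k]ks; have -> : (p%:Z * m + p%:Z = p%:Z * (m + 1))%R by ring.
  by rewrite form_tV_pop; congr (_, _); ring.
- exact: form_actK.
- by rewrite IH.
- by rewrite IHu // IHv.
- by rewrite !form_run_cat IHu // IHv //; apply: form_run_reduced.
Qed.

Section Evaluation.
Local Open Scope group_scope.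

Definition syllable_eval (x : syllable) : G :=
  match x with inl i => bs_a ^+ i * bs_t | inr i => bs_a ^+ i * bs_t^-1 end.

Fixpoint syllables_eval (s : seq syllable) : G :=
  if s is x :: s' then syllables_eval s' * syllable_eval x else 1.

Definition form_eval (x : bs_form) : G := syllables_eval x.1 * zpow bs_a x.2.

Lemma form_eval_act x l : form_eval (form_act x l) = form_eval x * cls [:: l].
Proof.
case: l => [[] []]; rewrite /form_eval /form_act.
- have -> : cls [:: (BSa, true)] = zpow bs_a (- 1)%R.
    exact: (presented_class_letterV _ (BSa, false)).
  by rewrite /= zpowD mulgA.
- by rewrite /= zpowS mulgA.
- rewrite (presented_class_letterV _ (BSt, false)) -/bs_t.
  case: form_tVP => [i s m -> /=|i m -> _ /=]; rewrite -!mulgA; congr (_ * _).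
    rewrite zpow_bs_tV zpowD; congr (_ * _).
    by rewrite mulgA mulgV mul1g.
  by rewrite zpowD -!mulgA zpow_bs_tV.
- rewrite -/bs_t.
  case: form_tP => [i s m -> /=|i m -> _ /=]; rewrite -!mulgA; congr (_ * _).
    rewrite zpow_bs_t zpowD; congr (_ * _).
    by rewrite mulgA mulVg mul1g.
  by rewrite zpowD -!mulgA zpow_bs_t.
Qed.

Lemma form_eval_run x w : form_eval (form_run x w) = form_eval x * cls w.
Proof.
elim: w x => [|l w IHw] x /=; first by rewrite presented_class_nil mulg1.
by rewrite [form_eval _]IHw form_eval_act -mulgA -presented_class_cons.
Qed.

Definition form1 : bs_form := ([::], 0%R).

Lemma form_eval1 : form_eval form1 = 1.
Proof. by rewrite /form_eval mulg1. Qed.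

Lemma form_run_onto x : reduced x -> exists w, form_run form1 w = x.
Proof.
case: x; elim=> [|x s IHs] k red.
  case: (leP 0%R k) => k0; [exists (nseq `|k| (BSa, false))|exists (nseq `|k| (BSa, true))].
    by rewrite /form1 form_run_a; congr (_, _); lia.
  by rewrite /form1 form_run_aV; congr (_, _); lia.
have [w wE] := IHs 0%R (reduced_behead red).
have [v vE] : exists v, form_run form1 v = (x :: s, 0%R).
  case: x red => i red.
    exists (w ++ nseq i (BSa, false) ++ [:: (BSt, false)]).
    rewrite !form_run_cat wE form_run_a /= add0r -[i%:Z%R]addr0 -(mulr0 q%:Z%R).
    by rewrite form_t_push // !mulr0.
  exists (w ++ nseq i (BSa, false) ++ [:: (BSt, true)]).
  rewrite !form_run_cat wE form_run_a /= add0r -[i%:Z%R]addr0 -(mulr0 p%:Z%R).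
  by rewrite form_tV_push // !mulr0.
case: (leP 0%R k) => k0.
  exists (v ++ nseq `|k| (BSa, false)).
  by rewrite form_run_cat vE form_run_a; congr (_, _); lia.
exists (v ++ nseq `|k| (BSa, true)).
by rewrite form_run_cat vE form_run_aV; congr (_, _); lia.
Qed.

(* Van der Waerden's trick: the group acts on reduced forms, and a reduced form
   is the image of the empty one under the element it stands for. *)
Lemma form_eval_inj x y : reduced x -> reduced y ->
  form_eval x = form_eval y -> x = y.
Proof.
move=> /form_run_onto[u <-] /form_run_onto[v <-].
rewrite !form_eval_run form_eval1 !mul1g => /presented_classP uv.
exact: form_run_presentation.
Qed.

Lemma form_eval_onto g : exists2 x, reduced x & form_eval x = g.
Proof.
exists (form_run form1 (repr g)); first exact: form_run_reduced.
by rewrite form_eval_run form_eval1 mul1g presented_classK.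
Qed.

Lemma form_eval_eq_run x y w : reduced x -> reduced y ->
  (form_eval y = form_eval x * cls w <-> y = form_run x w).
Proof.
move=> rx ry; split=> [|->]; last exact: form_eval_run.
by rewrite -form_eval_run => /form_eval_inj; apply=> //; apply: form_run_reduced.
Qed.

End Evaluation.
End NormalForm.

(** * Balanced ternary expansions *)

(* The trit [d : 'I_3] stands for the balanced digit [d - 1]; the least
   significant trit comes first. *)
Definition tritval (d : 'I_3) : int := (d%:Z - 1)%R.

Definition tritsval (w : seq 'I_3) : int :=
  foldr (fun d k => tritval d + 3 * k)%R 0%R w.

Definition trit0 : 'I_3 := inord 1.

Lemma tritval0 : tritval trit0 = 0%R.
Proof. by rewrite /tritval inordK. Qed.

(** A digit 0 in the high places changes nothing, so the exponent track can be stretched to the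
    length of the syllable track or of a convolution. *)
Lemma tritsval_pad w n : tritsval (w ++ nseq n trit0) = tritsval w.
Proof.
elim: w => [|d w /= -> //].
by elim: n => //= n ->; rewrite tritval0.
Qed.

Lemma tritsval_lt w : (`|tritsval w| < 3 ^ size w)%N.
Proof.
elim: w => //= d w; rewrite expnS /tritval; have := ltn_ord d.
move: (tritsval w) (3 ^ size w) => k N; lia.
Qed.

Lemma tritval_cons_inj d e j k :
  (tritval d + 3 * j = tritval e + 3 * k)%R -> d = e /\ j = k.
Proof.
rewrite /tritval => de; apply: (@euclid_inj 2) => /=; lia.
Qed.

Lemma tritval_divmod k : exists d j, k = (tritval d + 3 * j)%R.
Proof.
exists (inord `|((k + 1) %% 3%:Z)%Z|), ((k + 1) %/ 3%:Z)%Z.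
by rewrite /tritval modz_ord; have := divz_eq (k + 1)%R 3%:Z; lia.
Qed.

Section TritAutomata.

(** The state is the right-hand side still to be met by the remaining digits, or [None] once
    divisibility by 3 has failed. With [C = |e| + b + c], a carry bounded by [C] becomes at most
    [(C + b + c) / 3 <= C], so finitely many carries occur. *)
Lemma recognizable_trit_linear (b c : nat) (e : int) :
  recognizable (fun w : seq ('I_3 * 'I_3) =>
    b%:Z * tritsval (map fst w) - c%:Z * tritsval (map snd w) = e)%R.
Proof.
pose step (s : option int) (x : 'I_3 * 'I_3) : option int :=
  if s is Some e then
    let e' := (e - b%:Z * tritval x.1 + c%:Z * tritval x.2)%R in
    if (3%:Z %| e')%Z then Some (e' %/ 3%:Z)%Z else None
  else None.
pose C := (`|e| + b + c)%N.
pose F := None :: [seq Some (i%:Z - C%:Z)%R | i <- iota 0 (C + C).+1].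
have FE e' : (Some e' \in F) = (`|e'| <= C)%N.
  rewrite /F in_cons orFb; apply/mapP/idP => [[i]|eC].
    by rewrite mem_iota => iC [->]; lia.
  by exists `|(e' + C%:Z)%R|%N; [rewrite mem_iota|congr Some]; lia.
have Fe : Some e \in F by rewrite FE /C; lia.
have trit3 d : [\/ tritval d = -1, tritval d = 0 | tritval d = 1]%R.
  by case: d => -[|[|[|]]] // ?; [constructor 1|constructor 2|constructor 3].
have Fstep s x : s \in F -> step s x \in F.
  case: s => [e'|] //=; rewrite FE; case: ifP => // /dvdzP[m e'm] e'C.
  rewrite e'm mulzK // FE.
  by move: e'm; case: (trit3 x.1) => ->; case: (trit3 x.2) => ->; lia.
have stepN w : foldl step None w = None by elim: w.
apply: eq_recognizable (recognizable_fold_closed (fun s => s == Some 0%R) Fe Fstep).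
move=> w; elim: w e {C F FE Fe Fstep} => [|x w IHw] e /=.
  by rewrite !mulr0 subr0; split=> [/eqP[->]|<-].
case: ifP => [/dvdzP[m em]|/negP ndiv].
  rewrite em mulzK // IHw; set j := tritsval _; set k := tritsval _; lia.
rewrite stepN; split=> // def; case: ndiv.
set j := tritsval _ in def; set k := tritsval _ in def.
by apply/dvdzP; exists (b%:Z * j - c%:Z * k)%R; lia.
Qed.

(** The state holds, modulo [n.+1], the value read so far and the power of 3 that weighs the next
    digit. *)
Lemma recognizable_trit_mod n (r : int) :
  recognizable (fun w : seq 'I_3 => tritsval w %% n.+1%:Z = r)%Z.
Proof.
pose N := n.+1%:Z%R.
pose step (s : int * int) (d : 'I_3) : int * int :=
  ((s.1 + s.2 * tritval d) %% N, 3 * s.2 %% N)%Z.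
pose I := [seq i%:Z%R | i <- iota 0 n.+1].
have IP k : (k %% N)%Z \in I.
  apply/mapP; exists `|(k %% N)%Z|%N; last by rewrite gez0_abs // modz_ge0.
  by have := ltz_pmod k (isT : (0 < N)%R); have := modz_ge0 k (isT : N != 0%R);
    rewrite mem_iota; lia.
have F0 : (0, 1 %% N)%Z \in [seq (x, y) | x <- I, y <- I].
  by apply/allpairsP; exists (0, 1 %% N)%Z; rewrite IP; split=> //;
    have := IP 0%R; rewrite mod0z.
have Fstep s d : s \in [seq (x, y) | x <- I, y <- I] ->
    step s d \in [seq (x, y) | x <- I, y <- I].
  by move=> _; apply/allpairsP; exists (step s d); rewrite !IP.
apply: eq_recognizable (recognizable_fold_closed (fun s => s.1 == r) F0 Fstep).
move=> w.
suff this x y : (foldl step (x %% N, y %% N)%Z w).1 = ((x + y * tritsval w) %% N)%Z.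
  by have := this 0%R 1%R; rewrite mod0z add0r mul1r => ->; split=> /eqP.
elim: w x y => [|d w IHw] x y /=; first by rewrite mulr0 addr0.
rewrite /step /= IHw.
set k := tritsval w; set t := tritval d.
have -> : (x + y * (t + 3 * k) = ((x %/ N)%Z + (y %/ N)%Z * (t + 3 * k)) * N
    + ((x %% N)%Z + (y %% N)%Z * t + 3 * (y %% N)%Z * k))%R.
  by rewrite {1}(divz_eq x N) {1}(divz_eq y N); ring.
by rewrite modzMDl.
Qed.

End TritAutomata.

(** The tracks must agree until the first one ends, where the second carries [x] and ends one letter
    later. Pushing a syllable has this shape, and popping one has it with the tracks swapped. *)
Lemma recognizable_push (T : finType) (x : T) :
  recognizable (fun w : seq (option T * option T) => exists v n m,
    map fst w = map Some v ++ nseq n None /\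
    map snd w = map Some (rcons v x) ++ nseq m None).
Proof.
pose step (s : option bool) (y : option T * option T) : option bool :=
  match s, y with
  | Some false, (Some a, Some b) => if a == b then Some false else None
  | Some false, (None, Some b) => if x == b then Some true else None
  | Some true, (None, None) => Some true
  | _, _ => None
  end.
apply: eq_recognizable (recognizable_fold (Some false) step
  (fun s => s == Some true)) => w.
have stepN u : foldl step None u = None by elim: u.
have stepT u : foldl step (Some true) u == Some true <->
    exists n, map fst u = nseq n None /\ map snd u = nseq n None.
  elim: u => [|[[a|] [b|]] u IHu] /=; rewrite ?stepN.
  - by split=> // _; exists 0%N.
  - by split=> // -[[|n] []].
  - by split=> // -[[|n] []].
  - by split=> // -[[|n] []].
  apply: (iff_trans IHu); split=> -[n [u1 u2]]; first by exists n.+1; rewrite u1 u2.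
  by case: n u1 u2 => //= n [u1] [u2]; exists n.
have szE u v n m : map fst u = map Some v ++ nseq n None ->
    map snd u = map Some (rcons v x) ++ nseq m None -> n = m.+1.
  move=> /(congr1 size) e1 /(congr1 size); move: e1.
  by rewrite !size_map !size_cat !size_map !size_nseq size_rcons => ->; lia.
elim: w => [|[[a|] [b|]] w IHw] /=; rewrite ?stepN.
- by split=> // -[[|? ?] [n [m []]]].
- case: (a =P b) => [<-|ab]; rewrite ?stepN.
    apply: (iff_trans IHw); split=> -[v [n [m [w1 w2]]]].
      by exists (a :: v), n, m; rewrite /= w1 w2.
    by case: v w1 w2 => [|c v] /=; [case: n|move=> [-> w1] [w2]; exists v, n, m].
  split=> // -[[|c v] [n [m []]]] /=; first by case: n.
  by move=> [<- _] [/esym].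
- by split=> // -[[|c v] [n [m []]]].
- case: (x =P b) => [<-|xb]; rewrite ?stepN.
    apply: (iff_trans (stepT w)); split=> [[n [w1 w2]]|[v [n [m [w1 w2]]]]].
      by exists [::], n.+1, n; rewrite /= w1 w2.
    case: v w1 w2 => [|c v] //= w1 [w2]; exists m.
    by have nm := szE (((None, Some x)) :: w) [::] n m w1 (congr1 (cons (Some x)) w2);
      move: w1; rewrite nm => -[].
  split=> // -[[|c v] [n [m []]]] //= _ [/esym/xb[]].
- by split=> // -[[|c v] [n [m []]]].
Qed.

(** * Encoding of normal forms as words on two tracks *)

Section Encoding.
Variables p' q' : nat.
Notation p := p'.+1.
Notation q := q'.+1.
Notation G := (BS p q).
Notation syllable := (syllable p' q').
Notation bs_form := (bs_form p' q').

(** Eliminating the quotient [m] from [form_t] turns each case into a residue modulo q and one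
    linear equation between the exponents, both of which an automaton can check on trits. *)
Lemma form_t_relation (x y : bs_form) : reduced x -> reduced y ->
  (y = form_t x <->
   (exists i : 'I_q, [/\ y.1 = inl i :: x.1, (x.2 %% q%:Z)%Z = i%:Z
      & p%:Z * x.2 - q%:Z * y.2 = p%:Z * i%:Z]%R) \/
   (exists i : 'I_p, [/\ x.1 = inr i :: y.1, (x.2 %% q%:Z)%Z = 0%R
      & p%:Z * x.2 - q%:Z * y.2 = - (q%:Z * i%:Z)]%R)).
Proof.
move=> rx ry; split.
  move=> ->; case: form_tP => [i s m ->|i m xE _] /=.
    right; exists i; split=> //; first by rewrite mulrC modzMl.
    by ring.
  left; exists i; rewrite xE; split=> //; last by ring.
  by rewrite addrC mulrC modzMDl modz_small //; have := ltn_ord i; lia.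
case: x y rx ry => s k [s' k'] rx ry /= [[i [s'E kE kk']]|[i [sE kE kk']]].
  have := divz_eq k q%:Z; rewrite kE addrC mulrC => kE'.
  rewrite kE' form_t_push; last by rewrite -s'E.
  rewrite s'E; congr (_, _); apply: (@mulfI _ q%:Z%R) => //.
  have -> : (q%:Z * k' = p%:Z * k - p%:Z * i%:Z)%R by rewrite -kk'; ring.
  by rewrite {1}kE'; ring.
have := divz_eq k q%:Z; rewrite kE addr0 mulrC => kE'.
rewrite sE kE' form_t_pop; congr (_, _); apply: (@mulfI _ q%:Z%R) => //.
have -> : (q%:Z * k' = p%:Z * k + q%:Z * i%:Z)%R by rewrite -[(q%:Z * i%:Z)%R]opprK -kk'; ring.
by rewrite {1}kE'; ring.
Qed.

Definition bs_letter : finType := (option syllable * 'I_3)%type.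
Definition blank : bs_letter := (None, trit0).

Definition form_of_word (w : seq bs_letter) : bs_form :=
  (rev (pmap fst w), tritsval (map snd w)).

(* Each form is encoded in two tracks, the syllables from left to right and
   the balanced ternary expansion of the exponent, extended by blanks to a
   common length; as the last letter must not be blank, words are unique. *)
Definition canonical_word : set (seq bs_letter) :=
  [set w | last true (map (predC1 blank) w) /\
     exists v n, map fst w = map Some v ++ nseq n None /\
                 sorted (fun x y => sub_reduced y x) v].

Lemma canonical_word_recognizable : recognizable canonical_word.
Proof.
apply: recognizableI; first exact: recognizable_last.
exact: (@recognizable_map _ _ fst _ (recognizable_pad (recognizable_sorted _))).
Qed.

Lemma pmap_fst (w : seq bs_letter) : pmap fst w = pmap id (map fst w).
Proof. by elim: w => //= x w ->. Qed.

Lemma canonical_word_track w : canonical_word w ->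
  exists n, map fst w = map Some (rev (form_of_word w).1) ++ nseq n None.
Proof.
move=> [_ [v [n [w1 _]]]]; exists n; rewrite revK.
by rewrite pmap_fst w1 pmap_id_pad.
Qed.

Lemma canonical_word_reduced w : canonical_word w -> reduced (form_of_word w).
Proof.
move=> cw; have [n wn] := canonical_word_track cw; case: cw => _ [v [m [w1 sv]]].
rewrite /reduced; suff -> : (form_of_word w).1 = rev v by rewrite rev_sorted.
by rewrite -[LHS]revK -(pmap_id_pad (rev (form_of_word w).1) n) -wn w1 pmap_id_pad.
Qed.

Lemma blank_word_nil w : last true (map (predC1 blank) w) ->
  pmap fst w = [::] -> tritsval (map snd w) = 0%R -> w = [::].
Proof.
elim: w => // [[[x|] d] w] //= IHw lw w1.
rewrite -[0%R in X in _ = X](addr0 0%R) -{1}tritval0 -[0%R in X in _ = X](mulr0 3%R).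
move=> /tritval_cons_inj[d0 w2]; move: lw.
case: w IHw w1 w2 => [|y w] IHw w1 w2 /=; first by rewrite d0 eqxx.
by move=> lw; have := IHw lw w1 w2.
Qed.

Lemma canonical_word_inj u w : canonical_word u -> canonical_word w ->
  form_of_word u = form_of_word w -> u = w.
Proof.
move=> [lu [v [n [u1 _]]]] [lw [v' [m [w1 _]]]] [/(can_inj revK)].
rewrite !pmap_fst u1 w1 !pmap_id_pad => vv'; subst v'.
elim: u v n w m u1 w1 lu lw => [|[x d] u IHu] v n [|[y e] w] m //=.
- case: v => //= _ w1 _ lw w2; apply/esym/blank_word_nil => //.
  by rewrite pmap_fst [map _ _]w1 (pmap_id_pad [::]).
- case: v => //= u1 _ lu _ u2; apply/blank_word_nil => //.
  by rewrite pmap_fst [map _ _]u1 (pmap_id_pad [::]).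
- have lastS (z : bs_letter) t : last (z != blank) (map (predC1 blank) t) ->
     last true (map (predC1 blank) t) by case: t.
  move=> u1 w1 /lastS lu /lastS lw /tritval_cons_inj[-> uw].
  case: v u1 w1 => [|c v] /=.
    case: n m => [|n] [|m] //= [-> u1] [-> w1]; congr (_ :: _).
    exact: (IHu [::] n w m).
  by move=> [-> u1] [-> w1]; congr (_ :: _); apply: (IHu v n w m).
Qed.

Lemma canonical_word_onto x : reduced x ->
  exists2 w, canonical_word w & form_of_word w = x.
Proof.
case: x => s k red; pose v := rev s.
have sv : sorted (fun x y => sub_reduced y x) v by rewrite rev_sorted.
suff [w [lw [n w1] w2]] : exists w, [/\ last true (map (predC1 blank) w),
    exists n, map fst w = map Some v ++ nseq n None & tritsval (map snd w) = k].
  exists w; first by split=> //; exists v, n.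
  by rewrite /form_of_word pmap_fst w1 pmap_id_pad w2 revK.
(* [N] bounds both tracks at once: emitting a letter shortens a nonempty [v] and strictly decreases
   a nonzero [|k|]. *)
have [N] : exists N, (size v <= N)%N /\ (`|k| <= N)%N.
  by exists (size v + `|k|)%N; lia.
elim: N v k {sv red} => [|N IHN] v k [vN kN].
  have -> : v = [::] by apply/nilP; rewrite /nilp; lia.
  have -> : k = 0%R by lia.
  by exists [::]; split=> //; exists 0%N.
case: (v =P [::]) => [v0|/eqP v0]; first case: (k =P 0%R) => [->|/eqP k0].
- by rewrite v0; exists [::]; split=> //; exists 0%N.
- have [d [j kE]] := tritval_divmod k.
  have [|w [lw [n w1] w2]] := IHN [::] j; first split=> //.
    by move: kE kN; rewrite /tritval; have := ltn_ord d; lia.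
  exists ((None, d) :: w); split; last by rewrite /= w2 kE.
    case: w lw w1 w2 => //= _ _ j0; apply: contra k0 => /eqP[d0].
    by rewrite kE -j0 mulr0 addr0 d0 tritval0.
  by exists n.+1; rewrite v0 /= w1.
have [d [j kE]] := tritval_divmod k; case: v v0 vN => // c v _ vN.
have [|w [lw [n w1] w2]] := IHN v j; first split=> //.
  by move: kE kN; rewrite /tritval; have := ltn_ord d; lia.
exists ((Some c, d) :: w); split; last by rewrite /= w2 kE.
  by case: w lw {w1 w2}.
by exists n; rewrite /= w1.
Qed.

End Encoding.

(** * Cayley distance *)

Section CayleyMetric.
Variables (G : groupType) (A : {fset G}).
Local Open Scope group_scope.
Implicit Types w : seq (sym_gens A).

Lemma word_eval_cat u w : word_eval (u ++ w) = word_eval u * word_eval w.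
Proof. by rewrite /word_eval big_cat. Qed.

Lemma word_eval_cons s w : word_eval (s :: w) = val s * word_eval w.
Proof. by rewrite /word_eval big_cons. Qed.

Lemma word_eval_nil : word_eval ([::] : seq (sym_gens A)) = 1.
Proof. by rewrite /word_eval big_nil. Qed.

Lemma sym_gensP g :
  reflect (g \in A \/ g^-1 \in A) (g \in sym_gens A).
Proof.
rewrite in_fsetU; apply: (iffP orP) => -[gA|gA]; [by left| |by left|].
  by case/imfsetP: gA => a aA ->; right; rewrite invgK.
by right; apply/imfsetP; exists g^-1; rewrite ?invgK.
Qed.

Lemma sym_gensV g : g \in sym_gens A -> g^-1 \in sym_gens A.
Proof.
by case/sym_gensP=> gA; apply/sym_gensP; [right; rewrite invgK|left].
Qed.

Lemma cayley_edgeP x y :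
  reflect (exists s : sym_gens A, y = x * val s) (cayley_edge A x y).
Proof.
apply: (iffP existsP) => [[a /orP[]/eqP ->]|[[s sA] /= ->]].
- have aS : val a \in sym_gens A by apply/sym_gensP; left; apply: valP.
  by exists [` aS]%fset.
- have aS : (val a)^-1 \in sym_gens A.
    by apply/sym_gensV/sym_gensP; left; apply: valP.
  by exists [` aS]%fset; rewrite /= mulgK.
- case/sym_gensP: (sA) => aA; exists [` aA]%fset; rewrite /= ?eqxx //.
  by rewrite mulgK eqxx orbT.
Qed.

Lemma cayley_walkP x y n :
  cayley_walk A x y n <-> exists w, size w = n /\ y = x * word_eval w.
Proof.
split=> [[s [es <- <-]]|[w [<- ->]]].
  elim: s x es => [|z s IHs] x /=; first by exists [::]; rewrite word_eval_nil mulg1.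
  move=> /andP[/cayley_edgeP[c ->] /IHs[w [szw ->]]].
  by exists (c :: w); rewrite /= szw word_eval_cons mulgA.
elim: w x => [|c w IHw] x; first by exists [::]; rewrite word_eval_nil mulg1.
have [s [es ls szs]] := IHw (x * val c).
exists (x * val c :: s); rewrite /= es szs ls word_eval_cons mulgA; split=> //.
by rewrite andbT; apply/cayley_edgeP; exists c.
Qed.

Lemma cayley_dist_le w x y : y = x * word_eval w -> cayley_dist A x y <= size w.
Proof.
move=> yE; rewrite /cayley_dist; case: pselect => // exn.
case: ex_minnP => n _; apply; apply/asboolP/cayley_walkP.
by exists w.
Qed.

Lemma cayley_dist_word x y : generating A ->
  exists w, size w = cayley_dist A x y /\ y = x * word_eval w.
Proof.
move=> genA; rewrite /cayley_dist; case: pselect => [exn|[]]; last first.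
  have [w wE] := genA (x^-1 * y); exists (size w).
  by apply/asboolP/cayley_walkP; exists w; rewrite wE mulVKg.
by case: ex_minnP => n /asboolP/cayley_walkP.
Qed.

Definition in_ball n g := exists w, size w <= n /\ word_eval w = g.

Lemma in_ball0 : in_ball 0 1.
Proof. by exists [::]; rewrite word_eval_nil. Qed.

Lemma in_ballM m n g h : in_ball m g -> in_ball n h -> in_ball (m + n) (g * h).
Proof.
move=> [u [um <-]] [w [wn <-]]; exists (u ++ w).
by rewrite size_cat leq_add // word_eval_cat.
Qed.

Lemma in_ball_letter g : g \in sym_gens A -> in_ball 1 g.
Proof.
by move=> gA; exists [:: [` gA]%fset]; rewrite word_eval_cons word_eval_nil mulg1.
Qed.

Lemma in_ball_le m n g : m <= n -> in_ball m g -> in_ball n g.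
Proof. by move=> mn [w [wm wE]]; exists w; rewrite (leq_trans wm). Qed.

Lemma in_ball_word w : in_ball (size w) (word_eval w).
Proof. by exists w. Qed.

Lemma in_ballV n g : in_ball n g -> in_ball n g^-1.
Proof.
move=> [w [wn <-]]; apply: in_ball_le wn _.
elim: w => [|c w IHw]; first by rewrite word_eval_nil invg1; apply: in_ball0.
rewrite word_eval_cons invgM /= -addn1; apply: in_ballM => //.
exact/in_ball_letter/sym_gensV/valP.
Qed.

Lemma in_ball_dist n x y : in_ball n (x^-1 * y) -> cayley_dist A x y <= n.
Proof.
move=> [w [wn wE]]; apply: leq_trans (_ : size w <= n) => //.
by apply: cayley_dist_le; rewrite wE mulVKg.
Qed.

End CayleyMetric.

Lemma max_displacement_geq (G : groupType) (A : {fset G})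
    (L : set (seq (sym_gens A))) psi n w :
  L w -> size w <= n ->
  cayley_dist A (word_eval w) (psi w) <= max_displacement L psi n.
Proof.
move=> Lw wn; rewrite -[w]/(bseqval (Bseq wn)).
by apply: (@leq_bigmax_cond _ _ (fun w : n.-bseq (sym_gens A) =>
  cayley_dist A (word_eval w) (psi w))); apply/asboolP.
Qed.

(* Bernoulli: q^E >= (p + 1)^E >= p^E + E p^(E-1). *)
Lemma expn_dominates c p q : 0 < p -> p < q -> exists E, c * p ^ E <= q ^ E.
Proof.
move=> p0 pq; exists (c * p).+1.
suff H n : p ^ n.+1 + n.+1 * p ^ n <= q ^ n.+1.
  apply: leq_trans (H _); rewrite expnS.
  by move: (p ^ (c * p)) => N; nia.
elim: n => [|n IHn]; first by rewrite !expn1 expn0; lia.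
rewrite [q ^ n.+2]expnS; apply: leq_trans (leq_mul pq IHn).
rewrite !expnS; move: (p ^ n) => N; nia.
Qed.

(** * The representation *)

Section Representation.
Variables p' q' : nat.
Notation p := p'.+1.
Notation q := q'.+1.
Notation G := (BS p q).
Notation syllable := (syllable p' q').
Notation bs_form := (bs_form p' q').
Notation bs_letter := (bs_letter p' q').
Notation a := (bs_a p' q').
Notation t := (bs_t p' q').

(* Powers of a are thrown in so that there are enough letters to encode
   [bs_letter]. *)
Definition bs_gens : {fset G} :=
  [fset x in t :: [seq (a ^+ i.+1)%g | i <- iota 0 #|bs_letter|]]%fset.

Lemma bs_a_expg_inj : injective (fun n => a ^+ n)%g.
Proof.
move=> m n mn; have E k : (a ^+ k)%g = form_eval ([::] : seq syllable, k%:Z%R).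
  by rewrite /form_eval mul1g.
suff [] : ([::] : seq syllable, m%:Z%R) = ([::], n%:Z%R) by [].
by apply: form_eval_inj => //; rewrite -!E.
Qed.

Lemma bs_t_gens : t \in bs_gens.
Proof. by rewrite !inE eqxx. Qed.

Lemma bs_a_gens n : n < #|bs_letter| -> (a ^+ n.+1)%g \in bs_gens.
Proof.
move=> nN; rewrite !inE; apply/orP; right; apply/mapP; exists n => //.
by rewrite mem_iota.
Qed.

Lemma bs_gensP g : g \in bs_gens ->
  g = t \/ exists n, g = (a ^+ n.+1)%g.
Proof.
rewrite !inE => /orP[/eqP ->|/mapP[n _ ->]]; first by left.
by right; exists n.
Qed.

Lemma gens_sub_sym (H : groupType) (A : {fset H}) g : g \in A -> g \in sym_gens A.
Proof. by move=> gA; apply/sym_gensP; left. Qed.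

Definition encode (x : bs_letter) : sym_gens bs_gens :=
  [` gens_sub_sym (bs_a_gens (ltn_ord (enum_rank x)))]%fset.

Lemma encode_inj : injective encode.
Proof.
move=> x y /(congr1 val) /= /bs_a_expg_inj[] xy.
by apply: enum_rank_inj; apply: val_inj.
Qed.

Definition encoding (y : sym_gens bs_gens) : bool := [exists x, encode x == y].

Definition decode (y : sym_gens bs_gens) : bs_letter :=
  odflt (blank p' q') [pick x | encode x == y].

Lemma encodeK : cancel encode decode.
Proof.
move=> x; rewrite /decode; case: pickP => [y /eqP/encode_inj //|/(_ x)].
by rewrite eqxx.
Qed.

Lemma decodeK u : all encoding u -> map encode (map decode u) = u.
Proof.
by elim: u => //= y u IHu /andP[/existsP[x /eqP <-] /IHu ->]; rewrite encodeK.
Qed.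

Definition bs_lang : set (seq (sym_gens bs_gens)) :=
  [set u | all encoding u /\ canonical_word (map decode u)].

Definition bs_psi_form (u : seq (sym_gens bs_gens)) : bs_form :=
  form_of_word (map decode u).

Definition bs_psi (u : seq (sym_gens bs_gens)) : G := form_eval (bs_psi_form u).

Lemma bs_lang_recognizable : recognizable bs_lang.
Proof.
apply: recognizableI; first exact: recognizable_all.
exact: (@recognizable_map _ _ decode _ (canonical_word_recognizable _ _)).
Qed.

Lemma bs_psi_reduced u : bs_lang u -> reduced (bs_psi_form u).
Proof. by move=> [_ /canonical_word_reduced]. Qed.

Lemma bs_psi_bij : set_bij bs_lang [set: G] bs_psi.
Proof.
split=> // [u v|g _].
  rewrite !in_setE => Lu Lv uv; rewrite -(decodeK Lu.1) -(decodeK Lv.1).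
  congr map; apply: canonical_word_inj Lu.2 Lv.2 _.
  exact: form_eval_inj (bs_psi_reduced Lu) (bs_psi_reduced Lv) uv.
have [x rx <-] := form_eval_onto g; have [w cw <-] := canonical_word_onto rx.
exists (map encode w); rewrite /bs_psi /bs_psi_form /bs_lang /=;
  rewrite -map_comp (eq_map encodeK) map_id //.
split=> //; rewrite all_map; apply/allP => x' _; apply/existsP; by exists x'.
Qed.

(** Padding is read as a blank, which keeps each decoded track a syllable sequence followed by
    [None], or a ternary expansion followed by zeros. *)
Definition pad_decode (y : option (sym_gens bs_gens)) : bs_letter :=
  odflt (blank p' q') (omap decode y).

Lemma map_pad_decode u n :
  map pad_decode (map Some u ++ nseq n None) =
  map decode u ++ nseq n (blank p' q').
Proof. by rewrite map_cat map_nseq -map_comp. Qed.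

Definition pair_decode y := (pad_decode y.1, pad_decode y.2).

Definition pair_trits (x : bs_letter * bs_letter) := (x.1.2, x.2.2).

Definition pair_syllables (x : bs_letter * bs_letter) := (x.1.1, x.2.1).

Section Tracks.
Variables u v : seq (sym_gens bs_gens).
Hypotheses (Lu : bs_lang u) (Lv : bs_lang v).
Let w := map pair_decode (convolution u v).

Lemma trit_track1 : tritsval (map fst (map pair_trits w)) = (bs_psi_form u).2.
Proof.
have -> : map fst (map pair_trits w) =
    map snd (map pad_decode (map fst (convolution u v))) by rewrite -!map_comp.
rewrite map_fst_convolution map_pad_decode map_cat map_nseq.
exact: tritsval_pad.
Qed.

Lemma trit_track2 : tritsval (map snd (map pair_trits w)) = (bs_psi_form v).2.
Proof.
have -> : map snd (map pair_trits w) =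
    map snd (map pad_decode (map snd (convolution u v))) by rewrite -!map_comp.
rewrite map_snd_convolution map_pad_decode map_cat map_nseq.
exact: tritsval_pad.
Qed.

Lemma syllable_track1 : exists n,
  map fst (map pair_syllables w) =
  map Some (rev (bs_psi_form u).1) ++ nseq n None.
Proof.
have -> : map fst (map pair_syllables w) =
    map fst (map pad_decode (map fst (convolution u v))) by rewrite -!map_comp.
rewrite map_fst_convolution map_pad_decode map_cat map_nseq.
have [n ->] := canonical_word_track Lu.2; rewrite -catA -[(blank p' q').1]/None -nseqD.
by eexists.
Qed.

Lemma syllable_track2 : exists n,
  map snd (map pair_syllables w) =
  map Some (rev (bs_psi_form v).1) ++ nseq n None.
Proof.
have -> : map snd (map pair_syllables w) =
    map fst (map pad_decode (map snd (convolution u v))) by rewrite -!map_comp.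
rewrite map_snd_convolution map_pad_decode map_cat map_nseq.
have [n ->] := canonical_word_track Lv.2; rewrite -catA -[(blank p' q').1]/None -nseqD.
by eexists.
Qed.

Lemma syllable_tracks_eq :
  all (fun x => x.1 == x.2) (map pair_syllables w) <->
  (bs_psi_form u).1 = (bs_psi_form v).1.
Proof.
have [n w1] := syllable_track1; have [m w2] := syllable_track2.
have -> (T : eqType) (z : seq (T * T)) :
    all (fun x => x.1 == x.2) z = (map fst z == map snd z).
  by elim: z => //= x z ->; rewrite eqseq_cons.
split=> [/eqP|uv].
  by rewrite w1 w2 => /(congr1 (pmap id)); rewrite !pmap_id_pad => /(can_inj revK).
apply/eqP; rewrite w1 w2 uv; congr (_ ++ nseq _ _).
have := congr1 size w1; have := congr1 size w2.
by rewrite !size_cat !size_map !size_nseq uv; lia.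
Qed.

Lemma syllable_tracks_push c :
  (exists v' n m, map fst (map pair_syllables w) = map Some v' ++ nseq n None /\
    map snd (map pair_syllables w) = map Some (rcons v' c) ++ nseq m None) <->
  (bs_psi_form v).1 = c :: (bs_psi_form u).1.
Proof.
have [n w1] := syllable_track1; have [m w2] := syllable_track2.
rewrite w1 w2; split=> [[v' [n' [m' []]]]|->].
  move=> /(congr1 (pmap id)); rewrite !pmap_id_pad => <-.
  move=> /(congr1 (pmap id)); rewrite !pmap_id_pad -rev_cons.
  by move=> /(can_inj revK).
by exists (rev (bs_psi_form u).1), n, m; rewrite rev_cons.
Qed.

Lemma syllable_tracks_pop c :
  (exists v' n m, map snd (map pair_syllables w) = map Some v' ++ nseq n None /\
    map fst (map pair_syllables w) = map Some (rcons v' c) ++ nseq m None) <->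
  (bs_psi_form u).1 = c :: (bs_psi_form v).1.
Proof.
have [n w1] := syllable_track1; have [m w2] := syllable_track2.
rewrite w1 w2; split=> [[v' [n' [m' []]]]|->].
  move=> /(congr1 (pmap id)); rewrite !pmap_id_pad => <-.
  move=> /(congr1 (pmap id)); rewrite !pmap_id_pad -rev_cons.
  by move=> /(can_inj revK).
by exists (rev (bs_psi_form v).1), m, n; rewrite rev_cons.
Qed.

End Tracks.

Lemma bs_a_regular n :
  regular_rel [set uv | exists g : G, [/\ bs_lang uv.1, bs_lang uv.2,
    bs_psi uv.1 = g & bs_psi uv.2 = (g * a ^+ n)%g]].
Proof.
have rQ := recognizable_map pair_decode (recognizableI
  (recognizable_map pair_trits (recognizable_trit_linear 1 1 (- n%:Z)%R))
  (recognizable_map pair_syllables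
    (recognizable_all (fun x : option syllable * option syllable => x.1 == x.2)))).
apply: regular_rel_recognizable bs_lang_recognizable rQ _ => u v /=.
have E : bs_lang u -> bs_lang v -> bs_psi v = (bs_psi u * a ^+ n)%g <->
    bs_psi_form v = ((bs_psi_form u).1, (bs_psi_form u).2 + n%:Z)%R.
  move=> /bs_psi_reduced ru /bs_psi_reduced rv.
  rewrite -presented_class_nseq.
  apply: (iff_trans (form_eval_eq_run _ ru rv)).
  by case: (bs_psi_form u) => s k; rewrite form_run_a.
split=> [[g [Lu Lv <- /(E Lu Lv) ev]]|[Lu Lv [tr sy]]].
  split=> //; split.
    by rewrite trit_track1 trit_track2 ev /=; ring.
  by apply/syllable_tracks_eq; rewrite ?ev.
exists (bs_psi u); split=> //; apply/(E Lu Lv).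
move: tr sy; rewrite trit_track1 trit_track2 => tr.
move=> /(syllable_tracks_eq Lu Lv) ->.
by rewrite [LHS]surjective_pairing; congr (_, _); lia.
Qed.

Lemma bs_t_regular :
  regular_rel [set uv | exists g : G, [/\ bs_lang uv.1, bs_lang uv.2,
    bs_psi uv.1 = g & bs_psi uv.2 = (g * t)%g]].
Proof.
have rpush (i : 'I_q) := recognizableI
  (recognizable_map pair_trits (recognizableI
    (recognizable_map fst (recognizable_trit_mod q' i%:Z%R))
    (recognizable_trit_linear p q (p%:Z * i%:Z)%R)))
  (recognizable_map pair_syllables (recognizable_push (inl i : syllable))).
have rpop (i : 'I_p) := recognizableI
  (recognizable_map pair_trits (recognizableI
    (recognizable_map fst (recognizable_trit_mod q' 0%R))
    (recognizable_trit_linear p q (- (q%:Z * i%:Z))%R)))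
  (recognizable_map pair_syllables
    (recognizable_map (fun x => (x.2, x.1)) (recognizable_push (inr i : syllable)))).
have rQ := recognizable_map pair_decode
  (recognizableU (recognizable_exists rpush) (recognizable_exists rpop)).
apply: regular_rel_recognizable bs_lang_recognizable rQ _ => u v /=.
have E : bs_lang u -> bs_lang v -> bs_psi v = (bs_psi u * t)%g <->
    bs_psi_form v = form_t (bs_psi_form u).
  move=> /bs_psi_reduced ru /bs_psi_reduced rv.
  exact: (form_eval_eq_run [:: (BSt, false)] ru rv).
split=> [[g [Lu Lv <- /(E Lu Lv)]]|[Lu Lv H]].
  move=> /(form_t_relation (bs_psi_reduced Lu) (bs_psi_reduced Lv)) H.
  split=> //; case: H => -[i [s k kk]]; [left|right]; exists i; split.
  - by split; rewrite ?trit_track1 ?trit_track2.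
  - exact/(syllable_tracks_push Lu Lv).
  - by split; rewrite ?trit_track1 ?trit_track2.
  - have [v' [n [m [w1 w2]]]] := (syllable_tracks_pop Lu Lv _).2 s.
    by exists v', n, m; rewrite -w1 -w2 -!map_comp.
exists (bs_psi u); split=> //; apply/(E Lu Lv).
apply/(form_t_relation (bs_psi_reduced Lu) (bs_psi_reduced Lv)).
case: H => -[i [[]]]; rewrite trit_track1 trit_track2 => k kk H.
  by left; exists i; split=> //; apply/(syllable_tracks_push Lu Lv).
right; exists i; split=> //; apply/(syllable_tracks_pop Lu Lv).
by case: H => v' [n [m [w1 w2]]]; exists v', n, m; rewrite -w1 -w2 -!map_comp.
Qed.

Lemma bs_cayley_automatic_rep : cayley_automatic_rep bs_lang bs_psi.
Proof.
split; first exact/recognizable_regular/bs_lang_recognizable.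
  exact: bs_psi_bij.
move=> g /bs_gensP[->|[n ->]]; [exact: bs_t_regular|exact: bs_a_regular].
Qed.

(** The powers of [a] added for encoding thus reach [a^q], so that remainders modulo q and the
    exponents inside syllables cost one generator each. *)
Lemma card_bs_letter : q < #|bs_letter|.
Proof. by rewrite card_prod card_option card_sum !card_ord; lia. Qed.

Section Length.
Hypothesis pq : p' < q'.
Local Open Scope group_scope.

Lemma in_ball_t : in_ball bs_gens 1 t.
Proof. exact/in_ball_letter/gens_sub_sym/bs_t_gens. Qed.

Lemma in_ball_a n : n <= q -> in_ball bs_gens 1 (a ^+ n).
Proof.
case: n => [_|n nq]; first exact: in_ball_le (in_ball0 _).
apply/in_ball_letter/gens_sub_sym/bs_a_gens.
exact: ltn_trans nq card_bs_letter.
Qed.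

(* a^k = t a^(p m) t^-1 a^r for k = q m + r shrinks exponents by p / q. *)
Lemma in_ball_expg n k : k * p ^ n <= q ^ n.+1 ->
  in_ball bs_gens (3 * n + 1) (a ^+ k).
Proof.
elim: n k => [|n IHn] k; first by rewrite expn0 expn1 muln1 => /in_ball_a.
move=> kn.
have -> : a ^+ k = t * a ^+ (p * (k %/ q)) * t^-1 * a ^+ (k %% q).
  rewrite {1}(divn_eq k q) expgnDr; congr (_ * _).
  by have := zpow_bs_t p' q' (k %/ q)%N; rewrite /= mulnC => <-; rewrite mulgK.
have -> : (3 * n.+1 + 1 = 1 + (3 * n + 1) + 1 + 1)%N by lia.
apply: in_ballM; last by apply: in_ball_a; apply/ltnW/ltn_pmod.
apply: in_ballM; last exact/in_ballV/in_ball_t.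
apply: in_ballM; first exact: in_ball_t.
apply: IHn; rewrite -(@leq_pmul2l q) // -expnS; apply: leq_trans kn.
rewrite (expnS p) !mulnA leq_mul2r; apply/orP; right.
by rewrite mulnC mulnA leq_mul2r leq_divM orbT.
Qed.

Lemma in_ball_syllables (s : seq syllable) :
  in_ball bs_gens (2 * size s) (syllables_eval s).
Proof.
elim: s => [|x s IHs] /=; first exact: in_ball0.
rewrite mulnS addnC; apply: in_ballM => //; rewrite -[2%N]/(1 + 1)%N.
case: x => i /=; apply: in_ballM.
- by apply/in_ball_a/ltnW.
- exact: in_ball_t.
- by apply/in_ball_a; apply: leq_trans (ltnW (ltn_ord i)) _; apply: ltnW.
- exact/in_ballV/in_ball_t.
Qed.

End Length.

End Representation.

(** * Linear upper bound on the displacement *)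

Section UpperBound.
Variables p' q' : nat.
Hypothesis pq : p' < q'.
Notation p := p'.+1.
Notation q := q'.+1.
Notation G := (BS p q).
Notation bs_gens := (bs_gens p' q').
Notation bs_lang := (@bs_lang p' q').
Notation bs_psi := (@bs_psi p' q').
Notation bs_psi_form := (@bs_psi_form p' q').

Lemma in_ball_form s k n : (`|k| * p ^ n <= q ^ n.+1)%N ->
  in_ball bs_gens (2 * size s + (3 * n + 1)) (form_eval (s, k)).
Proof.
move=> /(in_ball_expg pq) kn; apply: in_ballM; first exact: in_ball_syllables.
case: k kn => k //=; exact: in_ballV.
Qed.

(** Once [(q/p)^E >= 3], the size of an exponent with [l] trits is beaten by [E * l] rounds of
    shrinking by [p / q]. *)
Lemma exp3_dominates E k l : 3 * p ^ E <= q ^ E -> k <= 3 ^ l ->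
  k * p ^ (E * l) <= q ^ (E * l).+1.
Proof.
move=> E3 kl; apply: leq_trans (_ : (3 * p ^ E) ^ l <= _).
  by rewrite expnMn expnM leq_mul2r kl orbT.
rewrite expnS expnM; apply: leq_trans (leq_pmull _ (isT : 0 < q)).
by case: l {kl} => // l; rewrite leq_exp2r.
Qed.

Lemma bs_gens_generating : generating bs_gens.
Proof.
move=> g; have [[s k] _ <-] := form_eval_onto g.
have [E E3] := expn_dominates 3 (isT : 0 < p) (pq : p < q).
have k3 : `|k|%N <= 3 ^ `|k|%N by apply/ltnW/ltn_expl.
have [w [_ wE]] := in_ball_form s (exp3_dominates E3 k3).
by exists w.
Qed.

Lemma bs_psi_size u :
  size (bs_psi_form u).1 <= size u /\ (`|(bs_psi_form u).2| < 3 ^ size u)%N.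
Proof.
split; last by have := tritsval_lt (map snd (map (@decode p' q') u)); rewrite !size_map.
rewrite size_rev size_pmap; apply: leq_trans (count_size _ _) _.
by rewrite size_map.
Qed.

(** Triangle inequality through the identity. In [3 * E + 4] the word itself accounts for 1, its
    syllables for 2, the exponent for [3 * E], and the additive 1 in the length of [a^k] for the
    rest. *)
Lemma bs_displacement_linear : exists C, forall n, 0 < n ->
  max_displacement bs_lang bs_psi n <= C * n.
Proof.
have [E E3] := expn_dominates 3 (isT : 0 < p) (pq : p < q).
exists (3 * E + 4) => n n0; apply/bigmax_leqP => u _.
have un := size_bseq u; have [su ku] := bs_psi_size u.
apply: leq_trans (in_ball_dist (in_ballM (in_ballV (in_ball_word u)) _)) _.
  rewrite /bs_psi; rewrite (surjective_pairing (bs_psi_form u)).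
  exact: in_ball_form (exp3_dominates E3 (ltnW ku)).
have EE : E * size u <= E * n by rewrite leq_mul2l un orbT.
rewrite mulnDl -mulnA; move: su un EE; set x := size _; set y := size _; set z := E * _; lia.
Qed.

Lemma bs_infinite : infinite_set [set: G]%classic.
Proof.
have inj : {in [set: nat]%classic &, injective (fun n => (bs_a p' q' ^+ n)%g)}.
  by move=> m n _ _; apply: bs_a_expg_inj.
apply: (@sub_infinite_set _
  ((fun n => (bs_a p' q' ^+ n)%g) @` [set: nat]%classic)%classic) => //.
by apply/infiniteP; have := inj_card_eq inj; rewrite card_eq_le => /andP[].
Qed.

Lemma bs_lang_nil : bs_lang [::].
Proof. by split=> //; split=> //; exists [::], 0%N. Qed.

Lemma bs_class_B_ident (R : realType) : class_B (ident_fun R) (BS p q).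
Proof.
have rep := @bs_cayley_automatic_rep p' q'; have gen := bs_gens_generating.
split; first exact: bs_infinite.
  by exists bs_gens, bs_lang, bs_psi.
exists bs_gens, bs_lang, bs_psi; split=> //.
have [C HC] := bs_displacement_linear; exists C.+1, 1%N, 1%N; split=> //=.
  by move=> n /= n0; split=> //; split=> //; exists [::]; split=> //; exact: bs_lang_nil.
move=> n n0; rewrite mul1n -natrM ler_nat; apply: leq_trans (HC n n0) _.
by rewrite leq_mul2r leqnSn orbT.
Qed.

End UpperBound.

(** * The area functional *)

Section Cocycle.
Local Open Scope ring_scope.
Variables p' q' : nat.
Hypothesis pq : (p' < q')%N.
Notation p := p'.+1.
Notation q := q'.+1.
Notation G := (BS p q).
Notation cls := (presented_class (bs_rels p q) : gword bs_gen -> G).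

Record bs_state := BSState { slope : rat; offset : rat; level : int }.

Definition bs_ratio : rat := q%:R / p%:R.

Definition level_jump (l y : rat) : int :=
  if (l == 1) && (y / q%:R \is a Num.int) then 1 else 0.

(* The pair (slope, offset) is the affine action x |-> slope x + offset with
   a : x |-> x + 1 and t : x |-> (q / p) x. The level counts the signed
   crossings of edges g -> g t with g in the kernel of the slope and offset
   divisible by q; it is well defined on the group because this set of g's is
   invariant under right multiplication by a^q. *)
Definition state_act (x : bs_state) (l : bs_gen * bool) : bs_state :=
  let: BSState s y k := x in
  match l with
  | (BSa, false) => BSState s (y + s) k
  | (BSa, true) => BSState s (y - s) k
  | (BSt, false) => BSState (s * bs_ratio) y (k + level_jump s y)
  | (BSt, true) => BSState (s / bs_ratio) y (k - level_jump (s / bs_ratio) y)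
  end.

Definition state_run (x : bs_state) (w : gword bs_gen) : bs_state :=
  foldl state_act x w.

Lemma state_run_cat x u v : state_run x (u ++ v) = state_run (state_run x u) v.
Proof. exact: foldl_cat. Qed.

Lemma bs_ratio_neq0 : bs_ratio != 0.
Proof. by rewrite mulf_neq0 ?invr_eq0 ?pnatr_eq0. Qed.

Lemma bs_ratio_gt1 : 1 < bs_ratio.
Proof. by rewrite /bs_ratio ltr_pdivlMr ?ltr0n // mul1r ltr_nat. Qed.

Lemma bs_ratioMp : bs_ratio * p%:R = q%:R.
Proof. by rewrite divfK // pnatr_eq0. Qed.

Lemma state_actK x l : state_act (state_act x l) (gletter_inv l) = x.
Proof.
case: x => s y k; case: l => [[] []] /=.
- by rewrite subrK.
- by rewrite addrK.
- by rewrite divfK ?bs_ratio_neq0 // subrK.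
- by rewrite mulfK ?bs_ratio_neq0 // addrK.
Qed.

Lemma state_run_a s y k n :
  state_run (BSState s y k) (nseq n (BSa, false)) = BSState s (y + s * n%:R) k.
Proof.
elim: n y => [|n IHn] y /=; first by rewrite mulr0 addr0.
by rewrite [LHS]IHn -[n.+1]add1n natrD; congr BSState; ring.
Qed.

Lemma level_jumpD s y (m : int) :
  level_jump s (y + s * (q%:R * m%:~R)) = level_jump s y.
Proof.
rewrite /level_jump; case: eqP => //= ->; rewrite mul1r mulrDl.
by rewrite [q%:R * _]mulrC mulfK ?pnatr_eq0 // rpredDr // intr_int.
Qed.

Lemma state_run_presentation u v : presentation_eq (bs_rels p q) u v ->
  forall x, state_run x u = state_run x v.
Proof.
elim=> {u v} [u v uv|l|u|u v _ IH|u v w _ IHu _ IHv|u u' v v' _ IHu _ IHv] x //.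
- have -> : u = [:: (BSt, false)] ++ nseq p (BSa, false) ++ [:: (BSt, true)].
    exact: (congr1 fst uv).
  have -> : v = nseq q (BSa, false) by exact: (congr1 snd uv).
  case: x => s y k; rewrite state_run_a !state_run_cat.
  rewrite -[state_run _ [:: (BSt, false)]]/(BSState _ _ _) state_run_a /=.
  rewrite mulfK ?bs_ratio_neq0 // -mulrA bs_ratioMp; congr BSState.
  by have := level_jumpD s y 1; rewrite mulr1 => ->; rewrite addrK.
- exact: state_actK.
- by rewrite IHu IHv.
- by rewrite !state_run_cat IHu IHv.
Qed.

Definition state1 := BSState 1 0 0.

Definition state_of (g : G) : bs_state := state_run state1 (repr g).

Lemma state_ofM g w : state_of (g * cls w)%g = state_run (state_of g) w.
Proof.
rewrite /state_of -state_run_cat; apply: state_run_presentation.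
by apply/presented_classP; rewrite presented_classK presented_classM presented_classK.
Qed.

Lemma state_of_class w : state_of (cls w) = state_run state1 w.
Proof. exact/state_run_presentation/repr_presented_class. Qed.

Lemma presented_class_inv w : cls (gword_inv w) = ((cls w)^-1)%g.
Proof.
apply/esym/mulg1_eq; rewrite -presented_classM.
exact/presented_classP/presentation_catV.
Qed.

(** Distance in the generators [a] and [t], whatever set [A] the representation is given over. *)
Definition near (n : nat) (x y : G) :=
  exists w, (size w <= n)%N /\ y = (x * cls w)%g.

Lemma near_sym n x y : near n x y -> near n y x.
Proof.
move=> [w [wn ->]]; exists (gword_inv w); rewrite size_rev size_map; split=> //.
by rewrite presented_class_inv mulgK.
Qed.

Lemma near_trans m n x y z : near m x y -> near n y z -> near (m + n) x z.
Proof.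
move=> [u [um ->]] [v [vn ->]]; exists (u ++ v).
by rewrite size_cat leq_add // presented_classM mulgA.
Qed.

Lemma near_le m n x y : (m <= n)%N -> near m x y -> near n x y.
Proof. by move=> mn [w [wm wE]]; exists w; rewrite (leq_trans wm). Qed.

Lemma near_refl x : near 0 x x.
Proof. by exists [::]; rewrite presented_class_nil mulg1. Qed.

Lemma level_jump_le1 s y : `|level_jump s y| <= 1.
Proof. by rewrite /level_jump; case: ifP. Qed.

Lemma level_lipschitz n x y : near n x y ->
  `|level (state_of y) - level (state_of x)| <= n%:R.
Proof.
move=> [w [wn ->]]; rewrite state_ofM.
apply: (@le_trans _ _ (size w)%:R); last by rewrite ler_nat.
elim: w (state_of x) {wn} => [|l w IHw] z /=; first by rewrite subrr.
have step : `|level (state_act z l) - level z| <= 1.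
  case: z => s c k; case: l => [[] []] /=; rewrite ?subrr //;
    by rewrite addrAC subrr add0r ?normrN level_jump_le1.
rewrite -(subrK (level (state_act z l)) (level (state_run _ _))) -addrA -natr1.
exact: le_trans (ler_normD _ _) (lerD (IHw _) step).
Qed.

(** The level moves only along a selected edge, in either direction, and [z] is the end of that edge
    with slope 1. *)
Lemma level_change_flat n x y : near n x y ->
  level (state_of y) != level (state_of x) ->
  exists z, [/\ slope (state_of z) = 1, near n x z & near n z y].
Proof.
move=> [w [wn ->]]; rewrite state_ofM => lw.
suff [u [v [wE uE]]] : exists u v, w = u ++ v /\ slope (state_run (state_of x) u) = 1.
  exists (x * cls u)%g; rewrite state_ofM; split=> //.
    by exists u; split=> //; apply: leq_trans wn; rewrite wE size_cat leq_addr.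
  exists v; rewrite wE presented_classM mulgA; split=> //.
  by apply: leq_trans wn; rewrite wE size_cat leq_addl.
elim: w (state_of x) lw {wn} => [|l w IHw] z /=; first by rewrite eqxx.
case: (eqVneq (level (state_act z l)) (level z)) => [<- /IHw[u [v [-> uE]]]|lz _].
  by exists (l :: u), v.
case: z lz => s c k; case: l => [[] []] /=; rewrite ?eqxx //.
  rewrite /level_jump; case: ifP; last by rewrite subr0 eqxx.
  by move=> /andP[/eqP s1 _] _; exists [:: (BSt, true)], w; rewrite /= s1.
rewrite /level_jump; case: ifP; last by rewrite addr0 eqxx.
by move=> /andP[/eqP s1 _] _; exists [::], ((BSt, false) :: w); rewrite /= s1.
Qed.

(** One letter multiplies the slope by at most [q / p <= q], or moves the offset by the slope. If
    slope and offset shift are both at most [q^k], their sum is at most [q^(k+1)] because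
    [q >= 2]. *)
Lemma offset_growth n x y : slope (state_of x) = 1 -> near n x y ->
  `|offset (state_of y) - offset (state_of x)| <= q%:R ^+ n.
Proof.
move=> x1 [w [wn ->]]; rewrite state_ofM.
have q1 : 1 <= q%:R :> rat by rewrite ler1n.
apply: (@le_trans _ _ (q%:R ^+ size w)); last exact: ler_weXn2l.
suff [_ H] : 0 <= slope (state_run (state_of x) w) <= q%:R ^+ size w /\
    `|offset (state_run (state_of x) w) - offset (state_of x)| + 1 <= q%:R ^+ size w.
  by apply: le_trans H; rewrite lerDl.
elim/last_ind: w {wn} => [|w l [/andP[s0 sq] IHw]].
  by rewrite /= x1 subrr normr0 add0r.
rewrite size_rcons exprS -cats1 state_run_cat.
move: s0 sq IHw; case: (state_run _ w) => s c k /= s0 sq cq.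
have qn1 : 1 <= q%:R ^+ size w :> rat by exact: exprn_ege1.
have q2 : 2 <= q%:R :> rat by rewrite ler_nat; lia.
have r0 : 0 < bs_ratio by apply: lt_trans bs_ratio_gt1.
have rq : bs_ratio <= q%:R.
  by rewrite /bs_ratio ler_pdivrMr ?ltr0n // ler_peMr ?ler0n // ler1n.
have rV : 0 <= bs_ratio^-1 <= 1.
  by rewrite invr_ge0 ltW //= invf_le1 // ltW // bs_ratio_gt1.
move: (q%:R ^+ size w) (offset _) cq sq qn1 => Q z cq sq Q1.
case: l => [[] []] /=.
- have -> : c - s - z = (c - z) - s by ring.
  have := ler_normB (c - z) s; rewrite (ger0_norm s0); split; nra.
- have -> : c + s - z = (c - z) + s by ring.
  have := ler_normD (c - z) s; rewrite (ger0_norm s0); split; nra.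
- move/andP: rV => [rV0 rV1]; move: (bs_ratio^-1) rV0 rV1 => r rV0 rV1.
  by split; [apply/andP; split|]; nra.
- by split; [apply/andP; split|]; nra.
Qed.

End Cocycle.

Section Area.
Local Open Scope ring_scope.
Variables p' q' : nat.
Hypothesis pq : (p' < q')%N.
Notation p := p'.+1.
Notation q := q'.+1.
Notation G := (BS p q).
Notation cls := (presented_class (bs_rels p q) : gword bs_gen -> G).
Notation near := (@near p' q').
Notation state_of := (@state_of p' q').
Notation state_act := (@state_act p' q').
Notation state_run := (@state_run p' q').
Notation level_jump := (level_jump q').

(** Twice the trapezoid rule for the integral of the offset against the level. *)
Definition state_area (x y : bs_state) : rat :=
  (level y - level x)%:~R * (offset x + offset y).

Definition area (x y : G) : rat := state_area (state_of x) (state_of y).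

(** Four sides of a square contribute at most [n * 2 * q^(3 n)] each, and [n <= q^n], [8 <= q^3]. *)
Definition area_bound (n : nat) : rat := q%:R ^+ (4 * n + 3).

(* If the level changes along the square, then a nearby z has slope 1, and
   offsets may be measured from z as the level increments add up to 0. *)
Lemma area_square n x x' y y' :
  near n x x' -> near n y y' -> near n x y -> near n x' y' ->
  `|area x x' + area x' y' - area y y' - area x y| <= area_bound n.
Proof.
move=> xx' yy' xy x'y'; rewrite /area /state_area.
pose lv g := level (state_of g); pose off g := offset (state_of g).
rewrite -!/(lv _) -!/(off _).
have q0 : 0 <= area_bound n by rewrite exprn_ge0.
have [[l1 l2 l3]|[z z1 [zx zy zx' zy']]] :
    [/\ lv x' = lv x, lv y = lv x & lv y' = lv x] \/
    exists2 z, slope (state_of z) = 1 &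
      [/\ near (3 * n) z x, near (3 * n) z y, near (3 * n) z x' & near (3 * n) z y'].
- have xx := near_refl x.
  have N m g h : near m g h -> (m <= 3 * n)%N -> near (3 * n) g h.
    by move=> gh mn; exact: near_le gh.
  have [l1|/(level_change_flat xx')[z [z1 xz zx']]] := eqVneq (lv x') (lv x); last first.
    right; exists z => //; have zx := near_sym xz; split.
    - by apply: N zx _; lia.
    - by apply: N (near_trans zx xy) _; lia.
    - by apply: N zx' _; lia.
    - by apply: N (near_trans zx' x'y') _; lia.
  have [l2|/(level_change_flat xy)[z [z1 xz zy]]] := eqVneq (lv y) (lv x); last first.
    right; exists z => //; have zx := near_sym xz; split.
    - by apply: N zx _; lia.
    - by apply: N zy _; lia.
    - by apply: N (near_trans zx xx') _; lia.
    - by apply: N (near_trans zy yy') _; lia.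
  have [l3|/(level_change_flat yy')[z [z1 yz zy']]] := eqVneq (lv y') (lv y); last first.
    right; exists z => //; have zy := near_sym yz; split.
    - by apply: N (near_trans zy (near_sym xy)) _; lia.
    - by apply: N zy _; lia.
    - by apply: N (near_trans zy' (near_sym x'y')) _; lia.
    - by apply: N zy' _; lia.
  by left; rewrite l3.
- by rewrite l1 l2 l3 !subrr !mul0r !(addr0, subr0) normr0.
have term g h : near n g h -> near (3 * n) z g -> near (3 * n) z h ->
    `|(lv h - lv g)%:~R * ((off g - off z) + (off h - off z))|
      <= n%:R * (q%:R ^+ (3 * n) *+ 2) :> rat.
  move=> gh /(offset_growth pq z1) zg /(offset_growth pq z1) zh; rewrite normrM ler_pM //.
    have := level_lipschitz gh; rewrite -/(lv g) -/(lv h) => gh'.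
    by rewrite -intr_norm -[n%:R]/(n%:Z%:~R) ler_int; apply: le_trans gh' _; rewrite natz.
  by rewrite mulr2n; apply: le_trans (ler_normD _ _) (lerD zg zh).
have -> : (lv x' - lv x)%:~R * (off x + off x') + (lv y' - lv x')%:~R * (off x' + off y')
    - (lv y' - lv y)%:~R * (off y + off y') - (lv y - lv x)%:~R * (off x + off y) =
  (lv x' - lv x)%:~R * ((off x - off z) + (off x' - off z))
  + (lv y' - lv x')%:~R * ((off x' - off z) + (off y' - off z))
  - (lv y' - lv y)%:~R * ((off y - off z) + (off y' - off z))
  - (lv y - lv x)%:~R * ((off x - off z) + (off y - off z)) :> rat.
  by rewrite !rmorphB /=; ring.
apply: (@le_trans _ _ ((n%:R * (q%:R ^+ (3 * n) *+ 2)) *+ 4)).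
  rewrite -[4%N]/(1 + 1 + 1 + 1)%N !mulrnDr !mulr1n.
  by apply: le_trans (ler_normB _ _) (lerD _ (term _ _ xy zx zy));
    apply: le_trans (ler_normB _ _) (lerD _ (term _ _ yy' zy zy'));
    apply: le_trans (ler_normD _ _) (lerD (term _ _ xx' zx zx') (term _ _ x'y' zx' zy')).
rewrite /area_bound -!natrX -!mulrnA -!natrM -?mulrnA ler_nat.
have nq : (n <= q ^ n)%N by apply/ltnW/ltn_expl; lia.
have q8 : (8 <= q ^ 3)%N by rewrite -[8%N]/(2 ^ 3)%N leq_exp2r //; lia.
have -> : (4 * n + 3 = n + 3 * n + 3)%N by lia.
have -> : (n * (q ^ (3 * n) * 2) * 4 = n * 8 * q ^ (3 * n))%N by lia.
by rewrite !expnD [leqRHS]mulnAC leq_mul2r leq_mul ?orbT.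
Qed.

(** The squares between two closed paths form an annulus; the areas of its rungs telescope to 0
    because both paths close up. *)
Lemma area_cycle n m (x y : nat -> G) :
  x m = x 0%N -> y m = y 0%N ->
  (forall i, (i < m)%N -> near n (x i) (x i.+1)) ->
  (forall i, (i < m)%N -> near n (y i) (y i.+1)) ->
  (forall i, (i <= m)%N -> near n (x i) (y i)) ->
  `|\sum_(i < m) area (x i) (x i.+1) - \sum_(i < m) area (y i) (y i.+1)|
    <= area_bound n *+ m.
Proof.
move=> xm ym xx yy xy.
have tele : \sum_(i < m) (area (x i.+1) (y i.+1) - area (x i) (y i)) = 0.
  rewrite -(big_mkord xpredT (fun i => area (x i.+1) (y i.+1) - area (x i) (y i))).
  by rewrite telescope_sumr // xm ym subrr.
have -> : \sum_(i < m) area (x i) (x i.+1) - \sum_(i < m) area (y i) (y i.+1) =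
    \sum_(i < m) (area (x i) (x i.+1) + area (x i.+1) (y i.+1)
      - area (y i) (y i.+1) - area (x i) (y i)).
  transitivity (\sum_(i < m) area (x i) (x i.+1) - \sum_(i < m) area (y i) (y i.+1)
    + \sum_(i < m) (area (x i.+1) (y i.+1) - area (x i) (y i))).
    by rewrite tele addr0.
  by rewrite -sumrB -big_split; apply: eq_bigr => i _ /=; ring.
rewrite -[X in _ *+ X]card_ord -sumr_const.
apply: le_trans (ler_norm_sum _ _ _) _; apply: ler_sum => i _.
by apply: area_square; [apply: xx|apply: yy|apply: xy|apply: xy] => //; apply: ltnW.
Qed.

Fixpoint path_area (x : bs_state) (w : gword bs_gen) : rat :=
  if w is l :: w' then state_area x (state_act x l) + path_area (state_act x l) w'
  else 0.

Lemma path_area_cat x u v :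
  path_area x (u ++ v) = path_area x u + path_area (state_run x u) v.
Proof. by elim: u x => [|l u IHu] x /=; rewrite ?add0r // IHu addrA. Qed.

Lemma state_runK x w : state_run (state_run x w) (gword_inv w) = x.
Proof.
elim/last_ind: w x => // w l IHw x.
rewrite -cats1 state_run_cat /gword_inv map_cat rev_cat /=.
by rewrite state_actK IHw.
Qed.

Lemma path_area_a x b : path_area x [:: (BSa, b)] = 0.
Proof. by case: x b => s y k [] /=; rewrite /state_area subrr mul0r addr0. Qed.

Lemma path_area_inv x w :
  path_area (state_run x w) (gword_inv w) = - path_area x w.
Proof.
elim/last_ind: w x => [|w l IHw] x; first by rewrite oppr0.
rewrite -cats1 path_area_cat state_run_cat /gword_inv map_cat rev_cat /=.
rewrite state_actK IHw /= addr0 opprD [RHS]addrC; congr (_ + _).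
by rewrite /state_area -opprB rmorphN mulNr [offset _ + offset _]addrC.
Qed.

Lemma path_area_class w :
  \sum_(i < size w) area (cls (take i w)) (cls (take i.+1 w)) =
  path_area (state1) w.
Proof.
elim/last_ind: w => [|w l IHw]; first by rewrite big_ord0.
rewrite size_rcons big_ord_recr /= -cats1 path_area_cat -IHw /= addr0.
congr (_ + _).
  apply: eq_bigr => i _; have := ltn_ord i => iw.
  by rewrite !takel_cat // ltnW.
rewrite take_size_cat // take_oversize ?size_cat ?addn1 // /area !state_of_class.
by rewrite state_run_cat.
Qed.

End Area.

(** * Area of the commutator loops *)

Section Loop.
Local Open Scope ring_scope.
Variables p' q' : nat.
Notation p := p'.+1.
Notation q := q'.+1.
Notation G := (BS p q).
Notation cls := (presented_class (bs_rels p q) : gword bs_gen -> G).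
Notation state_act := (@state_act p' q').
Notation state_run := (@state_run p' q').
Notation path_area := (@path_area p' q').
Notation bs_ratio := (bs_ratio p' q').
Notation level_jump := (level_jump q').
Notation letter_a := (BSa, false).
Notation letter_t := (BSt, false).
Notation letter_tV := (BSt, true).

Fixpoint power_exp (n : nat) : nat :=
  if n is m.+1 then (q * (power_exp m %/ p).+1)%N else 1%N.

(* A word of linear length for a ^ power_exp n; the exponent is first rounded
   up to a multiple of p so that conjugation by t multiplies it by q / p. *)
Fixpoint power_word (n : nat) : gword bs_gen :=
  if n is m.+1 then
    letter_t :: power_word m
      ++ nseq (p * (power_exp m %/ p).+1 - power_exp m) letter_a ++ [:: letter_tV]
  else [:: letter_a].

Lemma power_exp_round n : (power_exp n <= p * (power_exp n %/ p).+1)%N.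
Proof. by rewrite mulnC; apply/ltnW/ltn_ceil. Qed.

Lemma power_exp_growth n : (q ^ n <= power_exp n * p ^ n)%N.
Proof.
elim: n => // n IHn /=; rewrite !expnS.
apply: leq_trans (leq_mul (leqnn q) IHn) _.
have := power_exp_round n; move: (power_exp n %/ p).+1 (power_exp n) (p ^ n)%N => c N P Nc.
by have := leq_mul Nc (leqnn P); rewrite -!mulnA leq_pmul2l //; nia.
Qed.

Lemma size_power_word n : (size (power_word n) <= (p + 2) * n.+1)%N.
Proof.
elim: n => [|n IHn] /=; first by lia.
rewrite !size_cat size_nseq /=.
suff : (p * (power_exp n %/ p).+1 - power_exp n <= p)%N by lia.
by rewrite leq_subLR mulnS addnC leq_add2r mulnC leq_divM.
Qed.

Lemma power_word_class n : cls (power_word n) = (bs_a p' q' ^+ power_exp n)%g.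
Proof.
elim: n => // n IHn.
rewrite [power_word n.+1]/= presented_class_cons !presented_classM IHn.
rewrite presented_class_nseq (presented_class_letterV _ letter_t).
rewrite [X in (_ * X)%g]mulgA -expgnDr subnKC ?power_exp_round // mulgA.
by have := zpow_bs_t p' q' (power_exp n %/ p).+1; rewrite [LHS]/= => <-; rewrite mulgK.
Qed.

Lemma bs_ratio_round n :
  bs_ratio * (p * (power_exp n %/ p).+1)%:R = (power_exp n.+1)%:R.
Proof. by rewrite natrM mulrA bs_ratioMp -natrM. Qed.

Definition loop_word (n : nat) : gword bs_gen :=
  power_word n.+1 ++ [:: letter_a] ++ gword_inv (power_word n.+1) ++ [:: (BSa, true)].

Lemma size_loop_word n : (size (loop_word n) <= 2 * (p + 3) * n.+2)%N.
Proof.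
rewrite /loop_word !size_cat size_rev size_map.
by have := size_power_word n.+1; move: (size _) => /=; lia.
Qed.

Lemma loop_word_class n : cls (loop_word n) = 1%g.
Proof.
rewrite /loop_word !presented_classM presented_class_inv power_word_class.
rewrite (presented_class_letterV _ letter_a) -/(bs_a p' q').
by rewrite mulgA -expgSr -invgM -expgS mulgV.
Qed.

Hypothesis pq : (p' < q')%N.

(** All edges labelled [t] on this run issue from slope at least [q / p > 1], so none is selected
    and the level stays put after each of them. *)
Lemma state_run_power_word_high s y k n : bs_ratio <= s ->
  state_run (BSState s y k) (power_word n) =
    BSState s (y + s * (power_exp n)%:R) k /\
  path_area (BSState s y k) (power_word n) = 0.
Proof.
have jump0 z c : bs_ratio <= z -> level_jump z c = 0.
  rewrite /level_jump; case: eqP => // -> /(lt_le_trans (bs_ratio_gt1 pq)).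
  by rewrite ltxx.
have ratio_le z : bs_ratio <= z -> bs_ratio <= z * bs_ratio.
  have := bs_ratio_gt1 pq; nra.
have flat z c d (l : bs_gen * bool) : level (state_act z l) = level z ->
  state_area z (state_act z l) = 0.
  by rewrite /state_area => ->; rewrite subrr mul0r.
have flat_a z m : path_area z (nseq m letter_a) = 0.
  elim: m z => //= m IHm [z c j]; rewrite [path_area _ _]IHm addr0.
  by rewrite /state_area subrr mul0r.
elim: n s y k => [|n IHn] s y k rs.
  by rewrite /= mulr1 /state_area subrr mul0r addr0.
rewrite [power_word n.+1]/= -cat1s !path_area_cat !state_run_cat.
rewrite -[state_run _ [:: letter_t]]/(BSState (s * bs_ratio) y (k + level_jump s y)).
have [-> ->] := IHn (s * bs_ratio) y (k + level_jump s y) (ratio_le _ rs).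
rewrite state_run_a flat_a /= /state_area /= mulfK ?bs_ratio_neq0 // !jump0 //.
rewrite !(addr0, subr0, subrr, mul0r); split=> //; congr BSState.
by rewrite -addrA -mulrDr -natrD subnKC ?power_exp_round // -mulrA bs_ratio_round.
Qed.

(** Only the outermost [t] and [t^-1] can be selected. They are crossed at offsets [y] and [y + N]
    with [N = power_exp n.+1], a multiple of q; hence both count or neither does, and the area is 0
    or [2 y - 2 (y + N)]. *)
Lemma state_run_power_word y k n :
  state_run (BSState 1 y k) (power_word n.+1) =
    BSState 1 (y + (power_exp n.+1)%:R) k /\
  path_area (BSState 1 y k) (power_word n.+1) =
    - (level_jump 1 y)%:~R * (power_exp n.+1)%:R *+ 2.
Proof.
have flat_a z m : path_area z (nseq m letter_a) = 0.
  elim: m z => //= m IHm [z c j]; rewrite [path_area _ _]IHm addr0.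
  by rewrite /state_area subrr mul0r.
rewrite [power_word n.+1]/= -cat1s !path_area_cat !state_run_cat.
rewrite -[state_run _ [:: letter_t]]/(BSState (1 * bs_ratio) y (k + level_jump 1 y)).
rewrite mul1r.
have [-> ->] := state_run_power_word_high y (k + level_jump 1 y) n (lexx bs_ratio).
rewrite state_run_a flat_a /= /state_area /= divff ?bs_ratio_neq0 //.
have -> : y + bs_ratio * (power_exp n)%:R +
    bs_ratio * (p * (power_exp n %/ p).+1 - power_exp n)%:R = y + (power_exp n.+1)%:R.
  by rewrite -addrA -mulrDr -natrD subnKC ?power_exp_round // bs_ratio_round.
have -> : level_jump 1 (y + (power_exp n.+1)%:R) = level_jump 1 y.
  have := level_jumpD q' 1 y (power_exp n %/ p).+1%:Z.
  by rewrite mul1r -[_%:~R]/(_%:R) -natrM => ->.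
split; first by rewrite addrK.
rewrite !(rmorphB, rmorphD, rmorphN) /=; ring.
Qed.

(** The first power word starts at offset 0 and is counted. Since it moves the offset by an integer
    that commutes with the shift by 1, the inverse copy retraces the run from offset 1, which
    contributes nothing as [1 / q] is not an integer. *)
Lemma path_area_loop_word n :
  path_area state1 (loop_word n) = - (power_exp n.+1)%:R *+ 2.
Proof.
rewrite /loop_word /state1 !path_area_cat.
have [-> ->] := state_run_power_word 0 0 n.
rewrite -[state_run _ [:: letter_a]]/(BSState 1 (_ + 1) 0) add0r.
have [e1 e2] := state_run_power_word 1 0 n; rewrite addrC in e1; rewrite -e1.
rewrite path_area_inv state_runK e2 !path_area_a.
have -> : level_jump 1 0 = 1 by rewrite /level_jump eqxx mul0r rpred0.
have -> : level_jump 1 1 = 0.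
  rewrite /level_jump eqxx div1r /=; case: ifP => // /intrP[m] qm.
  have : (q%:Z * m)%:~R = 1 :> rat by rewrite intrM -qm mulfV // pnatr_eq0.
  rewrite -[1]/(1%:~R) => /intr_inj qm1; exfalso; clear qm.
  have [] : (m <= 0 \/ 1 <= m)%R by lia.
    by nia.
  by nia.
by rewrite !(oppr0, mul0r, mul0rn, addr0) mulN1r.
Qed.

End Loop.

(** * Fellow travelling *)

Section RegularRelation.
Variables (T : finType) (R : set (seq T * seq T)).
Hypothesis regR : regular_rel R.

Lemma convolution_letters (u v : seq T) :
  exists w : seq (conv_letter T), map val w = convolution u v.
Proof.
have nz : all (fun x => x != (None, None)) (convolution u v).
  apply/(all_nthP (None, None)) => i; rewrite size_mkseq => iw.
  rewrite nth_mkseq //; apply/eqP => -[/eqP]; rewrite -[_ == None]negbK -/(isSome _).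
  have := onthTE u i; have := onthTE v i.
  by case: (onth u i) => //; case: (onth v i) => //=; lia.
elim: (convolution u v) nz => [|x w IHw] /=; first by exists [::].
by move=> /andP[xz /IHw[w' <-]]; exists (exist _ x xz :: w').
Qed.

Lemma pmap_take_convolution (u v : seq T) j :
  pmap id (map fst (take j (convolution u v))) = take j u /\
  pmap id (map snd (take j (convolution u v))) = take j v.
Proof.
have takepad k (z : seq T) n :
    pmap id (take k (map Some z ++ nseq n None)) = take k z.
  elim: z k => [|x z IHz] k /=; first by elim: n k => [|n IHn] [|k] /=.
  by case: k => //= k; rewrite IHz.
by rewrite !map_take map_fst_convolution map_snd_convolution !takepad.
Qed.

(* Completing a run by letters (None, _) only keeps u and shortens v, so a
   partner v of u that is much longer than u is not unique. *)
Lemma regular_rel_short_completion : exists D, forall u v, R (u, v) ->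
  [/\ forall j, exists x y, [/\ size x <= D, size y <= D
         & R (take j u ++ x, take j v ++ y)],
      size u + D < size v -> exists2 v', v' != v & R (u, v')
    & size v + D < size u -> exists2 u', u' != u & R (u', v)].
Proof.
have [M ME] := regR; exists #|dfa_state M| => u v Ruv.
have [w wE] := convolution_letters u v.
have acc : dfa_accept M w.
  have : conv_language R w by exists u, v.
  by rewrite ME.
(* The automaton is stopped after [j] letters and led to acceptance by a short run over [P]; the
   tracks of the accepted word extend the two prefixes. *)
have step (P : pred (conv_letter T)) j : all P (drop j w) ->
    exists w' u' v', [/\ all P w', size w' <= #|dfa_state M|, R (u', v'),
      u' = take j u ++ pmap id (map fst (map val w'))
    & v' = take j v ++ pmap id (map snd (map val w'))].
  move=> Pw; move: acc; rewrite /dfa_accept -(cat_take_drop j w) foldl_cat.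
  move=> /(foldl_dfa_short_completion Pw)[w' [Pw' szw' acc']].
  have [u' [v' [Ruv' E]]] : conv_language R (take j w ++ w').
    by rewrite ME /= /dfa_accept foldl_cat.
  have [tu tv] := pmap_take_convolution u v j.
  have u'E : u' = pmap id (map fst (convolution u' v')).
    by rewrite map_fst_convolution pmap_id_pad.
  have v'E : v' = pmap id (map snd (convolution u' v')).
    by rewrite map_snd_convolution pmap_id_pad.
  exists w', u', v'; split=> //.
    by rewrite {1}u'E -E !map_cat pmap_cat map_take wE tu.
  by rewrite {1}v'E -E !map_cat pmap_cat map_take wE tv.
have size_fst (w' : seq (conv_letter T)) : size (pmap id (map fst (map val w'))) <= size w'.
  by rewrite size_pmap; apply: leq_trans (count_size _ _) _; rewrite !size_map.
have size_snd (w' : seq (conv_letter T)) : size (pmap id (map snd (map val w'))) <= size w'.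
  by rewrite size_pmap; apply: leq_trans (count_size _ _) _; rewrite !size_map.
split=> [j|uv|vu].
- have [|w' [u' [v' [_ szw' Ruv' eu ev]]]] := step predT j; first exact: all_predT.
  exists (pmap id (map fst (map val w'))), (pmap id (map snd (map val w'))).
  by rewrite -eu -ev !(leq_trans _ szw').
- have [|w' [u' [v' [Pw' szw' Ruv' eu ev]]]] := step (fun l => ~~ (val l).1) (size u).
    have -> w' : all (fun l : conv_letter T => ~~ (val l).1) w' =
        all (fun x => ~~ isSome x) (map fst (map val w')) by rewrite !all_map.
    rewrite !map_drop wE map_fst_convolution drop_size_cat ?size_map //.
    by rewrite all_nseq orbT.
  have u'u : u' = u.
    rewrite eu take_size; suff -> : pmap id (map fst (map val w')) = [::] by rewrite cats0.
    by elim: w' Pw' {szw' eu ev} => //= -[[[x|] y] xy] w' IHw' //= /IHw'.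
  exists v'; last by rewrite -u'u.
  apply/eqP => /(congr1 size); rewrite ev size_cat => E.
  move: E szw' uv (size_snd w'); rewrite size_take_min; clear.
  move: #|_| (size (pmap _ _)) (size w') (size u) (size v); lia.
- have [|w' [u' [v' [Pw' szw' Ruv' eu ev]]]] := step (fun l => ~~ (val l).2) (size v).
    have -> w' : all (fun l : conv_letter T => ~~ (val l).2) w' =
        all (fun x => ~~ isSome x) (map snd (map val w')) by rewrite !all_map.
    rewrite !map_drop wE map_snd_convolution drop_size_cat ?size_map //.
    by rewrite all_nseq orbT.
  have v'v : v' = v.
    rewrite ev take_size; suff -> : pmap id (map snd (map val w')) = [::] by rewrite cats0.
    by elim: w' Pw' {szw' eu ev} => //= -[[x [y|]] xy] w' IHw' //= /IHw'.
  exists u'; last by rewrite -v'v.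
  apply/eqP => /(congr1 size); rewrite eu size_cat => E.
  move: E szw' vu (size_fst w'); rewrite size_take_min; clear.
  move: #|_| (size (pmap _ _)) (size w') (size u) (size v); lia.
Qed.

End RegularRelation.

Section FellowTraveller.
Variables (G : groupType) (A : {fset G}).
Variables (L : set (seq (sym_gens A))) (psi : seq (sym_gens A) -> G).
Hypotheses (genA : generating A) (repL : cayley_automatic_rep L psi).
Local Open Scope group_scope.
Notation h := (max_displacement L psi).

(** The slack [D] in the conditions on [n] leaves room for short completions of the prefixes, whose
    displacement is then still controlled by [h n]. There is no restriction on [j], so prefixes may
    already be whole words. *)
Definition fellow (D : nat) (s : G) : Prop :=
  forall u v, L u -> L v -> psi v = psi u * s ->
  [/\ size v <= size u + D, size u <= size v + D
    & forall n j, size u + D <= n -> size v + D <= n ->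
      in_ball A (D * (h n).+1) ((word_eval (take j u))^-1 * word_eval (take j v))].

Lemma psi_inj u v : L u -> L v -> psi u = psi v -> u = v.
Proof. by case: repL => _ [_ inj _] _ Lu Lv; apply: inj; rewrite in_setE. Qed.

Lemma psi_onto g : exists2 u, L u & psi u = g.
Proof. by case: repL => _ [_ _ sur] _; have [u Lu <-] := sur g I; exists u. Qed.

Lemma fellow_le D E s : D <= E -> fellow D s -> fellow E s.
Proof.
move=> DE fD u v Lu Lv uv; have [vu uv' H] := fD u v Lu Lv uv.
move: vu uv' H; move: (size u) (size v) => a b vu uv' H.
split; [by lia|by lia|move=> n j un vn].
by apply: in_ball_le (H n j _ _); [rewrite leq_mul2r DE orbT|lia|lia].
Qed.

Lemma word_eval_displacement n u : L u -> size u <= n ->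
  in_ball A (h n) ((word_eval u)^-1 * psi u).
Proof.
move=> Lu un; apply: in_ball_le (max_displacement_geq psi Lu un) _.
have [z [zs zE]] := cayley_dist_word (word_eval u) (psi u) genA.
by rewrite -zs zE mulKg; apply: in_ball_word.
Qed.

(** From one prefix to the other: a completion ([D]), the displacement of the completed word
    ([h n]), the generator (1), then a displacement and a completion backwards. The lengths are
    comparable because bijectivity of [psi] makes partners unique. *)
Lemma fellow_gen s : s \in A -> exists D, fellow D s.
Proof.
move=> sA; have [_ _ /(_ s sA) /regular_rel_short_completion[D HD]] := repL.
exists (2 * D + 2) => u v Lu Lv uv.
have [|Hj Huv Hvu] := HD u v; first by exists (psi u).
split; last move=> n j un vn.
- rewrite leqNgt; apply/negP => lt; case: Huv.
    by move: lt; move: (size u) (size v) => b c; lia.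
  move=> v' /eqP v'v [g /= [_ Lv' gu gv]]; apply: v'v.
  by apply: psi_inj => //; rewrite gv -gu uv.
- rewrite leqNgt; apply/negP => lt; case: Hvu.
    by move: lt; move: (size u) (size v) => b c; lia.
  move=> u' /eqP u'u [g /= [Lu' _ gu gv]]; apply: u'u.
  by apply: psi_inj => //; apply: (mulIg s); rewrite gu -gv.
have [x [y [xD yD [g /= [Lx Ly gx gy]]]]] := Hj j.
have szx : (size (take j u ++ x) <= n)%N.
  rewrite size_cat size_take_min; move: xD un; move: (size u) (size x) => b c; lia.
have szy : (size (take j v ++ y) <= n)%N.
  rewrite size_cat size_take_min; move: yD vn; move: (size v) (size y) => b c; lia.
have -> : (word_eval (take j u))^-1 * word_eval (take j v) =
    word_eval x * ((word_eval (take j u ++ x))^-1 * psi (take j u ++ x)) * s *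
    ((word_eval (take j v ++ y))^-1 * psi (take j v ++ y))^-1 * (word_eval y)^-1.
  rewrite gy -gx !word_eval_cat !invgM !invgK !mulgA mulgV mul1g.
  by rewrite !mulgK.
apply: in_ball_le (_ : (D + h n + 1 + h n + D <= _)%N) _.
  by move: (h n) => N; nia.
apply: in_ballM; last by apply/in_ballV/(in_ball_le yD)/in_ball_word.
apply: in_ballM; last exact/in_ballV/word_eval_displacement.
apply: in_ballM; last by apply/in_ball_letter/sym_gensP; left.
apply: in_ballM; last exact: word_eval_displacement.
exact/(in_ball_le xD)/in_ball_word.
Qed.

Lemma fellow1 : fellow 0 1.
Proof.
move=> u v Lu Lv; rewrite mulg1 => /esym/(psi_inj Lu Lv) <-.
by rewrite !addn0; split=> // n j _ _; rewrite mulVg; apply: in_ball0.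
Qed.

Lemma fellowV D s : fellow D s -> fellow D s^-1.
Proof.
move=> fs u v Lu Lv uv; have [|vu uv' H] := fs v u Lv Lu; first by rewrite uv mulgVK.
split=> // n j un vn.
by rewrite -[X in in_ball _ _ (_ * X)]invgK -invgM; apply/in_ballV/H.
Qed.

(** Passes through the representative [w] of [psi u * s]. It may exceed [u] by [D] and itself
    requires the slack [D] or [E], whence the factor 2. *)
Lemma fellowM D E s r : fellow D s -> fellow E r -> fellow (2 * (D + E)) (s * r).
Proof.
move=> fs fr u v Lu Lv; rewrite mulgA => uv.
have [w Lw wE] := psi_onto (psi u * s); rewrite -wE in uv.
have [wu uw Hs] := fs u w Lu Lw wE; have [vw wv Hr] := fr w v Lw Lv uv.
move: wu uw vw wv Hs Hr; move: (size u) (size v) (size w) => a b c wu uw vw wv Hs Hr.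
split; [by lia|by lia|move=> n j un vn].
have -> : (word_eval (take j u))^-1 * word_eval (take j v) =
    ((word_eval (take j u))^-1 * word_eval (take j w)) *
    ((word_eval (take j w))^-1 * word_eval (take j v)).
  by rewrite !mulgA mulgK.
apply: in_ball_le (in_ballM (Hs n j _ _) (Hr n j _ _)); lia.
Qed.

(** Regularity is given for the generators in [A] only, whereas the loops are spelled with [a] and
    [t]. *)
Lemma fellow_all s : exists D, fellow D s.
Proof.
have [w <-] := genA s; elim: w => [|c w [E fE]].
  by rewrite word_eval_nil; exists 0; apply: fellow1.
rewrite word_eval_cons; suff [D fD] : exists D, fellow D (val c).
  by exists (2 * (D + E))%N; apply: fellowM.
case/sym_gensP: (valP c) => /fellow_gen[D fD]; exists D => //.
by rewrite -[val c]invgK; apply: fellowV.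
Qed.

Lemma fellow_uniform (T : finType) (f : T -> G) :
  exists D, forall x, fellow D (f x).
Proof.
have /choice[d dE] x : exists D, fellow D (f x) by exact: fellow_all.
exists (\max_x d x) => x; apply: fellow_le (dE x).
exact: leq_bigmax.
Qed.

End FellowTraveller.

(** * The lower bound *)

Section LowerBound.
Variables p' q' : nat.
Hypothesis pq : p' < q'.
Notation p := p'.+1.
Notation q := q'.+1.
Notation G := (BS p q).
Notation cls := (presented_class (bs_rels p q) : gword bs_gen -> G).
Notation near := (@near p' q').
Notation area := (@area p' q').
Variables (A : {fset G}) (L : set (seq (sym_gens A))) (psi : seq (sym_gens A) -> G).
Hypotheses (genA : generating A) (repL : cayley_automatic_rep L psi).
Notation h := (max_displacement L psi).

Lemma in_ball_near : exists B, forall n x y,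
  in_ball A n (x^-1 * y)%g -> near (B * n) x y.
Proof.
exists (\max_(s : sym_gens A) size (repr (val s))) => n x y [w [wn wE]].
set B := \max_s _; apply: near_le (_ : B * size w <= _) _.
  by rewrite leq_mul2l wn orbT.
have -> : y = (x * word_eval w)%g by rewrite wE mulVKg.
elim: w x {wn wE} => [|s w IHw] x.
  by rewrite word_eval_nil mulg1 muln0; apply: near_refl.
rewrite word_eval_cons mulgA /= mulnS; apply: near_trans (IHw _).
exists (repr (val s)); rewrite presented_classK; split=> //.
exact: (leq_bigmax s).
Qed.

Lemma fellow_letters : exists D, forall l, fellow L psi D (cls [:: l]).
Proof.
pose f (x : bool * bool) := cls [:: (if x.1 then BSt else BSa, x.2)].
have [D fD] := fellow_uniform genA repL f.
by exists D => -[[] b]; [apply: (fD (false, b))|apply: (fD (true, b))].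
Qed.

Local Open Scope ring_scope.

(* The loop is filled by the grid of all prefixes of the representatives
   psi^-1 (g i) of its vertices: the area jumps by a bounded amount from the
   row of prefixes of length j to the next one. *)
Lemma loop_area_bound (B D N n : nat) (s : G -> seq (sym_gens A)) :
  (forall k x y, in_ball A k (x^-1 * y)%g -> near (B * k) x y) ->
  (forall l, fellow L psi D (cls [:: l])) ->
  (forall g, L (s g) /\ psi (s g) = g) ->
  let m := size (loop_word p' q' n) in
  let J := (size (s 1%g) + D * m + D)%N in
  (J <= N)%N ->
  (power_exp p' q' n.+1 <=
    J.+1 * m * q ^ (4 * (B * (D.+1 * (h N).+1)).+1 + 3))%N.
Proof.
move=> HB HD Hs m J JN.
(* The successor makes [l] positive, so that the unit steps of the loop are covered too. *)
set l := (B * _).+1; pose W := loop_word p' q' n.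
pose g i := cls (take i W); pose v i := s (g i).
have Lv i : L (v i) by case: (Hs (g i)).
have vg i : psi (v i) = g i by case: (Hs (g i)).
have gS i : (i < m)%N -> g i.+1 = (g i * cls [:: nth (BSa, false) W i])%g.
  by move=> im; rewrite /g (take_nth (BSa, false)) // -cats1 presented_classM.
have g0 : g 0%N = 1%g by rewrite /g take0.
have gm : g m = g 0%N by rewrite g0 /g take_size loop_word_class.
(* Each letter of the loop lengthens the representative by at most [D]; thus by row [J] every
   representative has been read completely. *)
have sv i : (i <= m)%N -> (size (v i) <= size (s 1%g) + D * i)%N.
  elim: i => [|i IHi] im; first by rewrite /v g0 muln0 addn0.
  have [|H _ _] := HD (nth (BSa, false) W i) (v i) (v i.+1) (Lv _) (Lv _).
    by rewrite !vg gS.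
  by apply: leq_trans H _; rewrite mulnS [(D + _)%N]addnC addnA leq_add2r IHi // ltnW.
have svJ i : (i <= m)%N -> (size (v i) + D <= J)%N.
  move=> im; rewrite /J leq_add2r; apply: leq_trans (sv i im) _.
  by rewrite leq_add2l leq_mul2l im orbT.
pose x j i := word_eval (take j (v i)).
have x0 j : x j m = x j 0%N by rewrite /x /v gm.
have near_l k y z : (k <= D.+1 * (h N).+1)%N -> in_ball A k (y^-1 * z)%g -> near l y z.
  move=> kl /HB; apply: near_le; rewrite /l; apply: leq_trans (leqnSn _).
  by rewrite leq_mul2l kl orbT.
have xx j i : (i < m)%N -> near l (x j i) (x j i.+1).
  move=> im; have [|_ _ H] := HD (nth (BSa, false) W i) (v i) (v i.+1) (Lv _) (Lv _).
    by rewrite !vg gS.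
  apply: (near_l (D * (h N).+1)%N); first by rewrite leq_mul2r leqnSn orbT.
  by apply: H; apply: leq_trans JN; apply: svJ => //; apply: ltnW.
have xS j i : near l (x j i) (x j.+1 i).
  apply: (near_l 1%N) => //.
  rewrite /x -[j.+1]addn1 takeD word_eval_cat mulKg.
  apply: in_ball_le (in_ball_word _); rewrite size_take_min; exact: geq_minl.
have xg i : (i <= m)%N -> near l (x J i) (g i).
  move=> im; have vJ : (size (v i) <= J)%N by apply: leq_trans (svJ i im); apply: leq_addr.
  apply: (near_l (h N)); first by rewrite mulSn; apply: leq_trans (leq_addr _ _).
  rewrite /x take_oversize // -vg; apply: word_eval_displacement => //.
  exact: leq_trans JN.
have gg i : (i < m)%N -> near l (g i) (g i.+1).
  by move=> im; exists [:: nth (BSa, false) W i]; rewrite gS.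
pose S j := \sum_(i < m) area (x j i) (x j i.+1).
(* Row 0 is constant at the identity and has area 0. *)
have SS j : `|S j| <= area_bound q' l *+ m *+ j.
  elim: j => [|j IHj].
    rewrite /S big1 ?normr0 // => i _.
    by rewrite /x !take0 /area /state_area subrr mul0r.
  rewrite mulrSr -[S j.+1](subrK (S j)) addrC.
  apply: le_trans (ler_normD _ _) (lerD IHj _).
  rewrite distrC.
  exact: (area_cycle pq (x0 j) (x0 j.+1) (xx j) (xx j.+1) (fun i _ => xS j i)).
(* One more annulus, with rungs bounded by the displacement, joins the full representatives to the
   loop; hence [J.+1] in the conclusion. *)
have ST : `|S J - \sum_(i < m) area (g i) (g i.+1)| <= area_bound q' l *+ m.
  exact: (area_cycle pq (x0 J) gm (xx J) gg xg).
have gE : \sum_(i < m) area (g i) (g i.+1) = - (power_exp p' q' n.+1)%:R *+ 2.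
  by rewrite -path_area_loop_word // -path_area_class.
have : (power_exp p' q' n.+1)%:R <= area_bound q' l *+ m *+ J.+1.
  apply: (@le_trans _ _ `|\sum_(i < m) area (g i) (g i.+1)|).
    by rewrite gE normrMn normrN normr_nat mulr2n lerDl.
  rewrite mulrSr -[X in `|X|](subrK (S J)) addrC.
  by apply: le_trans (ler_normD _ _) (lerD (SS J) _); rewrite distrC.
rewrite /area_bound -natrX -!mulrnA ler_nat => /leq_trans; apply.
by rewrite mulnC [(m * _)%N]mulnC.
Qed.

Lemma displacement_exp_bound : exists C, forall n N, (C * n.+1 <= N)%N ->
  (q ^ n.+1 <= p ^ n.+1 * (C * n.+1) ^ 2 * q ^ (C * (h N).+1))%N.
Proof.
have [B HB] := in_ball_near; have [D HD] := fellow_letters.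
have /choice[s Hs] g : exists u, L u /\ psi u = g.
  by have [u Lu <-] := psi_onto repL g; exists u.
(* Per unit of [n.+1], [c] bounds the length of the loop (using [n.+2 <= 2 * n.+1]) and [c'] the
   number [J.+1] of annuli; the summand with [B] in the next line absorbs the exponent
   [4 * l + 3]. *)
pose c := (4 * (p + 3))%N; pose c' := (size (s 1%g) + D * c + D + 1)%N.
exists (c + c' + (4 * (B * D.+1) + 7))%N => n N CN.
set C := (c + c' + _)%N in CN *.
have mc : (size (loop_word p' q' n) <= c * n.+1)%N.
  by apply: leq_trans (size_loop_word _ _ _) _; rewrite /c; lia.
have Jc : (size (s 1%g) + D * size (loop_word p' q' n) + D < c' * n.+1)%N.
  have := leq_mul (leqnn D) mc; rewrite /c'; move: (size _) (size _) => a b.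
  by rewrite !mulnDl !mulnA; nia.
have CE k : (k <= C)%N -> (k * n.+1 <= C * n.+1)%N by rewrite leq_mul2r => ->.
have cC : (c <= C)%N by rewrite /C; lia.
have c'C : (c' <= C)%N by rewrite /C; lia.
have JN := leq_trans (ltnW (leq_trans Jc (CE _ c'C))) CN.
have := loop_area_bound HB HD Hs JN; move: JN => _ bound.
apply: leq_trans (power_exp_growth p' _ _) _; rewrite [leqLHS]mulnC -[leqRHS]mulnA leq_mul2l.
apply/orP; right; apply: leq_trans bound _; apply: leq_mul.
  by rewrite expnS expn1; apply: leq_mul;
    [apply: leq_trans Jc (CE _ c'C)|apply: leq_trans mc (CE _ cC)].
rewrite leq_exp2l; last by lia.
apply: (@leq_trans ((4 * (B * D.+1) + 7) * (h N).+1)%N).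
  have -> := mulnA B D.+1 (h N).+1; move: (B * D.+1)%N (h N) => E H; nia.
by rewrite leq_mul2r leq_addl orbT.
Qed.

End LowerBound.

(** Logarithms of the exponential bound at [n.+1 = e * k], without real numbers: the constant
    [(C e)^2] is absorbed by [x <= q^x], and powers of q become powers of 2 by [q <= 2^q]. *)
Lemma displacement_linear_bound p' q' (A : {fset BS p'.+1 q'.+1})
    (L : set (seq (sym_gens A))) (psi : seq (sym_gens A) -> BS p'.+1 q'.+1) :
  p' < q' -> generating A -> cayley_automatic_rep L psi ->
  exists U V M, 0 < M /\
    forall k, 0 < k -> k <= U + V * max_displacement L psi (M * k).
Proof.
move=> pq genA repL; have [C HC] := displacement_exp_bound pq genA repL.
set p := p'.+1 in A L psi pq genA repL HC *; set q := q'.+1 in A L psi pq genA repL HC *.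
(* 16 is 4 times 4: one factor [4^k] absorbs the polynomial term [k^2], the other survives. *)
have [e e16] := expn_dominates 16 (isT : 0 < p) (pq : p < q).
exists (q * ((C * e) ^ 2 + C)), (q * C), (C.+1 * e.+1); split=> // k k0.
set H := max_displacement _ _ _.
have q1 : 1 < q by exact: leq_ltn_trans (leq0n p') pq.
have e0 : 0 < e.
  by case: e e16 {H} => //; rewrite !expn0.
have ek0 : (e * k).-1.+1 = e * k by rewrite prednK // muln_gt0 e0.
have := HC (e * k).-1 (C.+1 * e.+1 * k); rewrite ek0 -/H => /(_ _) bound.
have {bound} : q ^ (e * k) <= p ^ (e * k) * (C * (e * k)) ^ 2 * q ^ (C * H.+1).
  by apply: bound; rewrite mulnA leq_mul // leq_mul.
have /leq_trans le16 : 16 ^ k * p ^ (e * k) <= q ^ (e * k).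
  by rewrite !expnM -expnMn leq_exp2r.
move=> /le16; rewrite -mulnA [leqLHS]mulnC leq_pmul2l ?expn_gt0 // => {le16} le16.
have k2 : k <= 2 ^ k by exact/ltnW/ltn_expl.
have k4 : k ^ 2 <= 4 ^ k by rewrite -[4]/(2 ^ 2) -expnM mulnC expnM leq_exp2r.
have le4 : 4 ^ k <= (C * e) ^ 2 * q ^ (C * H.+1).
  rewrite -(@leq_pmul2l (4 ^ k)) ?expn_gt0 // -expnMn; apply: leq_trans le16 _.
  rewrite [leqRHS]mulnA leq_mul2r; apply/orP; right.
  by rewrite mulnA expnMn mulnC leq_mul2r k4 orbT.
rewrite -mulnA -mulnDr -addnA -mulnS -(@leq_exp2l 2) //.
apply: leq_trans (_ : 4 ^ k <= _); first by rewrite leq_exp2r.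
apply: leq_trans le4 _; rewrite [leqRHS]expnM.
apply: (@leq_trans (q ^ ((C * e) ^ 2 + C * H.+1))).
  by rewrite expnD leq_mul2r; apply/orP; right; apply/ltnW/ltn_expl; exact: q1.
move: (_ + _) => [|X] //; rewrite leq_exp2r //; exact/ltnW/ltn_expl.
Qed.

Theorem theorem13 (R : realType) (p q : nat) (hpq : (1 <= p < q)%N) :
  class_B (ident_fun R) (BS p q) /\
  (forall f : nat_pfun R,
     growth_fun f -> prec f (ident_fun R) -> ~ class_B f (BS p q)).
Proof.
case: p q hpq => // p [//|q] /andP[_ pq]; rewrite ltnS in pq.
split; first exact: bs_class_B_ident.
move=> f _ [fi nfi] [_ _ [A [L [psi [genA repL [K [M [N [K0 M0 N0 dom_f le_f]]]]]]]]].
(* What is missing for [asymp] is that the identity is dominated by [f]; this goes through the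
   displacement, which lies below [f] and linearly above the identity. *)
apply: nfi; split=> //.
have [U [V [M' [M'0 HU]]]] := displacement_linear_bound pq genA repL.
(* For [k > 2 * U] the additive constant takes less than half of [k], so [k <= 2 * V * h]; the
   summand [N] brings [M' * k] into the range where the displacement is bounded by [f]. *)
exists (2 * V.+1 * K)%N, (M * M')%N, (2 * U + N).+1; split=> //.
- by rewrite !muln_gt0 K0.
- by rewrite muln_gt0 M0.
- move=> k /= kN; split; first by apply: leq_trans kN.
  by have [] := dom_f k; last by []; apply: leq_trans kN; lia.
move=> k kN; have k0 : (0 < k)%N by apply: leq_trans kN.
have := HU k k0; set h := max_displacement _ _ _ => kh.
have kV : (k <= 2 * V.+1 * h)%N by nia.
have NM : (N <= M' * k)%N by nia.
have := le_f _ NM; rewrite /= -/h => hf.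
rewrite -(mulnA M) natrM -mulrA.
apply: (@le_trans _ _ ((2 * V.+1)%:R * h%:R)%R); first by rewrite -natrM ler_nat.
by rewrite ler_wpM2l.
Qed.
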